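(* Let $P\colon \mathcal{E}\to\mathcal{B}$ be a monoidal opfibration with tensor product $\otimes$. Suppose that each fibre $\mathcal{E}_B$ ($B\in\mathcal{B}$) of $P$ has reflexive coequalizers and that these are preserved by the direct image functors $f_*\colon\mathcal{E}_A\to\mathcal{E}_B$ ($f\colon A\to B$ in $\mathcal{B}$) and by the tensors $-\otimes E\colon \mathcal{E}_{P(E)}\to\mathcal{E}_{P(E)}$, for all $E\in\mathcal{E}$. Then both functors in the sequence $$\mathit{Mod}(P)\longrightarrow \mathit{Mon}(P)\longrightarrow\mathcal{B}$$ are opfibrations. The same is true in the commutative setting: if $P$ is a symmetric monoidal opfibration satisfying the same hypotheses, then both functors in the sequence $$\mathit{Mod}_c(P)\longrightarrow \mathit{Comm}(P)\longrightarrow\mathcal{B}$$ are opfibrations.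
   Context: For a functor $P\colon\mathcal{E}\to\mathcal{B}$ and $B\in\mathcal{B}$, $\mathcal{E}_B=P^{-1}(B)$ is the fibre category (objects over $B$, morphisms over $1_B$). ''Opfibration'' means Grothendieck opfibration; for $f\colon A\to B$ in $\mathcal{B}$, the direct image functor $f_*\colon\mathcal{E}_A\to\mathcal{E}_B$ is obtained by choosing opcartesian lifts. A monoidal opfibration over $\mathcal{B}$ is a monoidal object in the 2-category of opfibrations over $\mathcal{B}$, opcartesian functors over $\mathcal{B}$ and natural transformations over $\mathcal{B}$. That is, it consists of an opfibration $P\colon\mathcal{E}\to\mathcal{B}$, functors over $\mathcal{B}$ preserving opcartesian arrows $\otimes\colon\mathcal{E}\times_{\mathcal{B}}\mathcal{E}\to\mathcal{E}$ and $I\colon\mathcal{B}\to\mathcal{E}$ (also denoted $u$; $\mathcal{B}$ is viewed as an opfibration over itself via the identity), and natural isomorphisms over $\mathcal{B}$ (associator $\alpha$, left and right unitors $\lambda,\rho$) satisfying the usual monoidal coherence axioms in each fibre. Symmetric monoidal opfibrations are defined similarly (with a symmetry over $\mathcal{B}$). Each fibre $\mathcal{E}_B$ is then a (symmetric) monoidal category with unit $I_B=I(B)$. $\mathit{Mon}(P)$ (resp. $\mathit{Comm}(P)$, for $P$ symmetric): objects are monoids (resp. commutative monoids) in the fibres of $P$; a morphism $(R,\mu,\eta)\to(S,\nu,\lambda)$ is a morphism $\phi\colon R\to S$ in $\mathcal{E}$ such that $\nu\circ(\phi\otimes\phi)=\phi\circ\mu$ and $\lambda\circ I(P(\phi))=\phi\circ\eta$;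 composition is that of $\mathcal{E}$. The functor to $\mathcal{B}$ is induced by $P$. $\mathit{Mod}(P)$ (resp. $\mathit{Mod}_c(P)$): objects are pairs $(R,M)$ where $R$ is a monoid (resp. commutative monoid) in a fibre of $P$ and $M$ is a right $R$-module in $\mathcal{E}_{P(R)}$; a morphism $(R,(M,\kappa))\to(S,(N,\sigma))$ is a pair $(\phi,\alpha)$ with $\phi\colon R\to S$ a morphism of $\mathit{Mon}(P)$ and $\alpha\colon M\to N$ a morphism of $\mathcal{E}$ such that $P(\phi)=P(\alpha)$ and $\sigma\circ(\alpha\otimes\phi)=\alpha\circ\kappa$; composition is componentwise. The functor $\mathit{Mod}(P)\to\mathit{Mon}(P)$ (resp. $\mathit{Mod}_c(P)\to\mathit{Comm}(P)$) is the projection $(R,M)\mapsto R$. *)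

(* Defs.v *)
From Stdlib Require Import ProofIrrelevance IndefiniteDescription.

Set Implicit Arguments.
Unset Strict Implicit.
Unset Printing Implicit Defensive.

Declare Scope cat_scope.
Delimit Scope cat_scope with cat.
Open Scope cat_scope.

Record Category := {
  Ob :> Type;
  Hom : Ob -> Ob -> Type;
  idm : forall X, Hom X X;
  comp : forall X Y Z, Hom Y Z -> Hom X Y -> Hom X Z;
  comp_id_l : forall X Y (f : Hom X Y), comp (idm Y) f = f;
  comp_id_r : forall X Y (f : Hom X Y), comp f (idm X) = f;
  comp_assoc : forall W X Y Z (h : Hom Y Z) (g : Hom X Y) (f : Hom W X),
    comp h (comp g f) = comp (comp h g) f
}.
Arguments Hom {c} X Y.
Arguments idm {c} X.
Arguments comp {c X Y Z} g f.

Notation "g ∘ f" := (comp g f) (at level 40, left associativity) : cat_scope.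

Record Functor (C D : Category) := {
  fob :> Ob C -> Ob D;
  fmap : forall X Y : C, Hom X Y -> Hom (fob X) (fob Y);
  fmap_id : forall X : C, fmap (idm X) = idm (fob X);
  fmap_comp : forall (X Y Z : C) (g : Hom Y Z) (f : Hom X Y),
    fmap (g ∘ f) = fmap g ∘ fmap f
}.
Arguments fmap {C D} F {X Y} f : rename.

Definition functor_id (C : Category) : Functor C C :=
  {| fob := fun X => X; fmap := fun _ _ f => f;
     fmap_id := fun _ => eq_refl; fmap_comp := fun _ _ _ _ _ => eq_refl |}.

Definition functor_comp (C D E : Category) (G : Functor D E) (F : Functor C D) :
  Functor C E.
Proof.
refine {| fob := fun X => G (F X); fmap := fun _ _ f => fmap G (fmap F f) |}.
- intros X; rewrite !fmap_id; reflexivity.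
- intros X Y Z g f; rewrite !fmap_comp; reflexivity.
Defined.

Definition is_iso (C : Category) (X Y : C) (f : Hom X Y) : Prop :=
  exists g : Hom Y X, g ∘ f = idm X /\ f ∘ g = idm Y.

(** The set of all arrows of a category.  "[P f] is equal to [u]" is expressed
    in this set, as the endpoints of [P f] and [u] need only be propositionally
    equal. *)
Record Arr (C : Category) := Arrow { src : C; tgt : C; mor : Hom src tgt }.
Arguments Arrow {C src tgt} mor.

Lemma Arrow_inj (C : Category) (X Y : C) (f g : Hom X Y) :
  Arrow f = Arrow g -> f = g.
Proof.
intros H.
assert (K : forall (a b : Arr C), a = b ->
  forall (e : src a = src b) (e' : tgt a = tgt b),
  eq_rect _ (fun y => Hom (src b) y)
    (eq_rect _ (fun x => Hom x (tgt a)) (mor a) _ e) _ e' = mor b).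
{ intros a b []  e e'.
  rewrite (proof_irrelevance _ e eq_refl), (proof_irrelevance _ e' eq_refl).
  reflexivity. }
exact (K _ _ H eq_refl eq_refl).
Qed.

Lemma Arrow_comp (C : Category) (X Y Z X' Y' Z' : C)
  (f : Hom X Y) (g : Hom Y Z) (f' : Hom X' Y') (g' : Hom Y' Z') :
  Arrow f = Arrow f' -> Arrow g = Arrow g' -> Arrow (g ∘ f) = Arrow (g' ∘ f').
Proof.
intros Hf Hg.
assert (eX : X = X') by exact (f_equal (@src C) Hf).
assert (eY : Y = Y') by exact (f_equal (@tgt C) Hf).
assert (eZ : Z = Z') by exact (f_equal (@tgt C) Hg).
subst X' Y' Z'.
rewrite (Arrow_inj Hf), (Arrow_inj Hg); reflexivity.
Qed.

Lemma Arrow_id (C : Category) (X Y : C) : X = Y -> Arrow (idm X) = Arrow (idm Y).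
Proof. intros []; reflexivity. Qed.

Definition reflexive_pair (C : Category) (X Y : C) (f g : Hom X Y) : Prop :=
  exists s : Hom Y X, f ∘ s = idm Y /\ g ∘ s = idm Y.

Definition is_coequalizer (C : Category) (X Y Q : C) (f g : Hom X Y)
    (q : Hom Y Q) : Prop :=
  q ∘ f = q ∘ g /\
  forall (Z : C) (h : Hom Y Z), h ∘ f = h ∘ g -> exists! k : Hom Q Z, k ∘ q = h.

Definition has_reflexive_coequalizers (C : Category) : Prop :=
  forall (X Y : C) (f g : Hom X Y), reflexive_pair f g ->
  exists (Q : C) (q : Hom Y Q), is_coequalizer f g q.

Definition preserves_reflexive_coequalizers (C D : Category) (F : Functor C D) :
    Prop :=
  forall (X Y Q : C) (f g : Hom X Y) (q : Hom Y Q),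
  reflexive_pair f g -> is_coequalizer f g q ->
  is_coequalizer (fmap F f) (fmap F g) (fmap F q).

Record MonoidalCategory := {
  mcat :> Category;
  mtens : mcat -> mcat -> mcat;
  mtens_hom : forall X X' Y Y' : mcat,
    Hom X X' -> Hom Y Y' -> Hom (mtens X Y) (mtens X' Y');
  mtens_id : forall X Y : mcat, mtens_hom (idm X) (idm Y) = idm (mtens X Y);
  mtens_comp : forall (X X' X'' Y Y' Y'' : mcat) (f' : Hom X' X'') (f : Hom X X')
      (g' : Hom Y' Y'') (g : Hom Y Y'),
    mtens_hom (f' ∘ f) (g' ∘ g) = mtens_hom f' g' ∘ mtens_hom f g;
  munit : mcat;
  massoc : forall X Y Z : mcat, Hom (mtens (mtens X Y) Z) (mtens X (mtens Y Z));
  mlunit : forall X : mcat, Hom (mtens munit X) X;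
  mrunit : forall X : mcat, Hom (mtens X munit) X;
  massoc_nat : forall (X X' Y Y' Z Z' : mcat)
      (f : Hom X X') (g : Hom Y Y') (h : Hom Z Z'),
    massoc X' Y' Z' ∘ mtens_hom (mtens_hom f g) h
    = mtens_hom f (mtens_hom g h) ∘ massoc X Y Z;
  mlunit_nat : forall (X X' : mcat) (f : Hom X X'),
    mlunit X' ∘ mtens_hom (idm munit) f = f ∘ mlunit X;
  mrunit_nat : forall (X X' : mcat) (f : Hom X X'),
    mrunit X' ∘ mtens_hom f (idm munit) = f ∘ mrunit X;
  massoc_iso : forall X Y Z : mcat, is_iso (massoc X Y Z);
  mlunit_iso : forall X : mcat, is_iso (mlunit X);
  mrunit_iso : forall X : mcat, is_iso (mrunit X);
  mpentagon : forall W X Y Z : mcat,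
    massoc W X (mtens Y Z) ∘ massoc (mtens W X) Y Z
    = mtens_hom (idm W) (massoc X Y Z) ∘ massoc W (mtens X Y) Z
        ∘ mtens_hom (massoc W X Y) (idm Z);
  mtriangle : forall X Y : mcat,
    mtens_hom (idm X) (mlunit Y) ∘ massoc X munit Y
    = mtens_hom (mrunit X) (idm Y)
}.
Arguments mtens {m} X Y.
Arguments mtens_hom {m X X' Y Y'} f g.
Arguments munit {m}.
Arguments massoc {m} X Y Z.
Arguments mlunit {m} X.
Arguments mrunit {m} X.

Definition tensor_right (V : MonoidalCategory) (E : V) : Functor V V.
Proof.
refine {| fob := fun X : V => (mtens X E : V);
          fmap := fun _ _ f => mtens_hom f (idm E) |}.
- intros X; apply mtens_id.
- intros X Y Z g f.
  rewrite <- (comp_id_l (idm E)) at 1; apply mtens_comp.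
Defined.

Record Symmetry (V : MonoidalCategory) := {
  braid : forall X Y : V, Hom (mtens X Y) (mtens Y X);
  braid_nat : forall (X X' Y Y' : V) (f : Hom X X') (g : Hom Y Y'),
    braid X' Y' ∘ mtens_hom f g = mtens_hom g f ∘ braid X Y;
  braid_invol : forall X Y : V, braid Y X ∘ braid X Y = idm (mtens X Y);
  braid_hexagon : forall X Y Z : V,
    massoc Y Z X ∘ braid X (mtens Y Z) ∘ massoc X Y Z
    = mtens_hom (idm Y) (braid X Z) ∘ massoc Y X Z
        ∘ mtens_hom (braid X Y) (idm Z)
}.

Record Monoid (V : MonoidalCategory) (R : V) := {
  mon_mul : Hom (mtens R R) R;
  mon_one : Hom munit R;
  mon_assoc : mon_mul ∘ mtens_hom mon_mul (idm R)
              = mon_mul ∘ mtens_hom (idm R) mon_mul ∘ massoc R R R;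
  mon_one_l : mon_mul ∘ mtens_hom mon_one (idm R) = mlunit R;
  mon_one_r : mon_mul ∘ mtens_hom (idm R) mon_one = mrunit R
}.

Definition commutative (V : MonoidalCategory) (S : Symmetry V) (R : V)
    (m : Monoid R) : Prop :=
  mon_mul m ∘ braid S R R = mon_mul m.

Record RightModule (V : MonoidalCategory) (R : V) (m : Monoid R) (M : V) := {
  act : Hom (mtens M R) M;
  act_assoc : act ∘ mtens_hom act (idm R)
              = act ∘ mtens_hom (idm M) (mon_mul m) ∘ massoc M R R;
  act_one : act ∘ mtens_hom (idm M) (mon_one m) = mrunit M
}.

Record Fib (E B : Category) (P : Functor E B) (A : B) := MkFib {
  fib_ob :> Ob E;
  fib_over : P fib_ob = A
}.

Definition self (E B : Category) (P : Functor E B) (X : E) : Fib P (P X) :=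
  MkFib (P := P) (eq_refl (P X)).

Record HomOver (E B : Category) (P : Functor E B) (A A' : B) (u : Hom A A')
    (X : Fib P A) (Y : Fib P A') := MkHomOver {
  hom_of : Hom (fib_ob X) (fib_ob Y);
  hom_over : Arrow (fmap P hom_of) = Arrow u
}.

Definition self_hom (E B : Category) (P : Functor E B) (X Y : E) (f : Hom X Y) :
    HomOver (fmap P f) (self P X) (self P Y) :=
  @MkHomOver E B P (P X) (P Y) (fmap P f) (self P X) (self P Y) f eq_refl.

Lemma HomOver_eq (E B : Category) (P : Functor E B) (A A' : B) (u : Hom A A')
  (X : Fib P A) (Y : Fib P A') (f g : HomOver u X Y) :
  hom_of f = hom_of g -> f = g.
Proof.
destruct f as [f Hf], g as [g Hg]; simpl; intros e; subst g.
f_equal; apply proof_irrelevance.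
Qed.

Lemma over_id (E B : Category) (P : Functor E B) (A : B) (X : Fib P A) :
  Arrow (fmap P (idm (fib_ob X))) = Arrow (idm A).
Proof. rewrite fmap_id; apply Arrow_id, fib_over. Qed.

Lemma over_comp (E B : Category) (P : Functor E B) (A A' A'' : B)
  (v : Hom A' A'') (u : Hom A A') (X : Fib P A) (Y : Fib P A') (Z : Fib P A'')
  (g : HomOver v Y Z) (f : HomOver u X Y) :
  Arrow (fmap P (hom_of g ∘ hom_of f)) = Arrow (v ∘ u).
Proof. rewrite fmap_comp; apply Arrow_comp; apply hom_over. Qed.

Definition over_compose (E B : Category) (P : Functor E B) (A A' A'' : B)
    (v : Hom A' A'') (u : Hom A A') (X : Fib P A) (Y : Fib P A') (Z : Fib P A'')
    (g : HomOver v Y Z) (f : HomOver u X Y) : HomOver (v ∘ u) X Z :=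
  MkHomOver (over_comp g f).

Lemma over_fib_comp (E B : Category) (P : Functor E B) (A : B) (X Y Z : Fib P A)
  (g : HomOver (idm A) Y Z) (f : HomOver (idm A) X Y) :
  Arrow (fmap P (hom_of g ∘ hom_of f)) = Arrow (idm A).
Proof. rewrite over_comp, comp_id_l; reflexivity. Qed.

Definition Fibre (E B : Category) (P : Functor E B) (A : B) : Category.
Proof.
refine {| Ob := Fib P A;
          Hom := fun X Y => HomOver (idm A) X Y;
          idm := fun X => MkHomOver (over_id X);
          comp := fun X Y Z g f => MkHomOver (over_fib_comp g f) |}.
- intros X Y f; apply HomOver_eq, comp_id_l.
- intros X Y f; apply HomOver_eq, comp_id_r.
- intros W X Y Z h g f; apply HomOver_eq, comp_assoc.
Defined.

Definition opcartesian (E B : Category) (P : Functor E B) (X Y : E)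
    (g : Hom X Y) : Prop :=
  forall (Z : E) (h : Hom X Z) (w : Hom (P Y) (P Z)), w ∘ fmap P g = fmap P h ->
  exists! k : Hom Y Z, fmap P k = w /\ k ∘ g = h.

Definition is_opfibration (E B : Category) (P : Functor E B) : Prop :=
  forall (A A' : B) (u : Hom A A') (X : Fib P A),
  exists (Y : Fib P A') (g : HomOver u X Y), opcartesian P (hom_of g).

Record Cleavage (E B : Category) (P : Functor E B) := {
  lift_ob : forall (A A' : B) (u : Hom A A'), Fib P A -> Fib P A';
  lift : forall (A A' : B) (u : Hom A A') (X : Fib P A),
    HomOver u X (lift_ob u X);
  lift_opcartesian : forall (A A' : B) (u : Hom A A') (X : Fib P A),
    opcartesian P (hom_of (lift u X))
}.

Lemma opcartesian_over (E B : Category) (P : Functor E B) (A A' A'' : B)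
  (u : Hom A A') (w : Hom A' A'') (v : Hom A A'')
  (X : Fib P A) (Y : Fib P A') (Z : Fib P A'')
  (g : HomOver u X Y) (h : HomOver v X Z) :
  opcartesian P (hom_of g) -> w ∘ u = v ->
  exists! k : HomOver w Y Z, hom_of k ∘ hom_of g = hom_of h.
Proof.
destruct X as [X eX], Y as [Y eY], Z as [Z eZ], g as [g Hg], h as [h Hh].
cbn in *; intros og e; subst A A' A'' v.
apply Arrow_inj in Hg; subst u.
apply Arrow_inj in Hh.
destruct (og Z h w (eq_sym Hh)) as [k [[k1 k2] ku]].
subst w.
exists (@MkHomOver E B P (P Y) (P Z) (fmap P k) (self P Y) (self P Z) k eq_refl).
split; [exact k2|].
intros [k' Hk'] e'; apply HomOver_eq; cbn in *.
apply ku; split; [exact (Arrow_inj Hk') | exact e'].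
Qed.

(** The action of [u_*] on a morphism [k] of the fibre over [A]: the unique
    vertical morphism whose composite with the lift at [X] is the lift at [Y]
    after [k]. *)
Lemma direct_image_hom_subproof (E B : Category) (P : Functor E B)
  (c : Cleavage P) (A A' : B) (u : Hom A A') (X Y : Fib P A)
  (k : HomOver (idm A) X Y) :
  exists! k' : HomOver (idm A') (lift_ob c u X) (lift_ob c u Y),
    hom_of k' ∘ hom_of (lift c u X) = hom_of (lift c u Y) ∘ hom_of k.
Proof.
apply (opcartesian_over (over_compose (lift c u Y) k)
         (@lift_opcartesian _ _ _ c _ _ u X)).
rewrite comp_id_l, comp_id_r; reflexivity.
Qed.

Definition direct_image_hom (E B : Category) (P : Functor E B)
    (c : Cleavage P) (A A' : B) (u : Hom A A') (X Y : Fib P A)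
    (k : HomOver (idm A) X Y) :
    HomOver (idm A') (lift_ob c u X) (lift_ob c u Y) :=
  proj1_sig (constructive_definite_description _
               (direct_image_hom_subproof c u k)).

Lemma direct_image_homE (E B : Category) (P : Functor E B)
  (c : Cleavage P) (A A' : B) (u : Hom A A') (X Y : Fib P A)
  (k : HomOver (idm A) X Y) :
  hom_of (direct_image_hom c u k) ∘ hom_of (lift c u X)
  = hom_of (lift c u Y) ∘ hom_of k.
Proof. unfold direct_image_hom; apply proj2_sig. Qed.

Lemma direct_image_hom_uniq (E B : Category) (P : Functor E B)
  (c : Cleavage P) (A A' : B) (u : Hom A A') (X Y : Fib P A)
  (k : HomOver (idm A) X Y)
  (k' : HomOver (idm A') (lift_ob c u X) (lift_ob c u Y)) :
  hom_of k' ∘ hom_of (lift c u X) = hom_of (lift c u Y) ∘ hom_of k ->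
  direct_image_hom c u k = k'.
Proof.
intros e; destruct (direct_image_hom_subproof c u k) as [k0 [_ uk]].
rewrite <- (uk _ e); symmetry; apply uk, direct_image_homE.
Qed.

Definition direct_image (E B : Category) (P : Functor E B)
  (c : Cleavage P) (A A' : B) (u : Hom A A') : Functor (Fibre P A) (Fibre P A').
Proof.
refine {| fob := fun X : Fibre P A => (lift_ob c u X : Fibre P A');
          fmap := fun X Y (k : Hom X Y) =>
            (direct_image_hom c u k : @Hom (Fibre P A') _ _) |}.
- intros X; apply direct_image_hom_uniq; cbn.
  rewrite comp_id_l, comp_id_r; reflexivity.
- intros X Y Z g f; apply direct_image_hom_uniq; cbn.
  rewrite <- comp_assoc, direct_image_homE, !comp_assoc, direct_image_homE.
  reflexivity.
Defined.

(** Functors [F] with [Q ∘ F = P]. *)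
Record FunctorOver (E E' B : Category) (P : Functor E B) (Q : Functor E' B) := {
  fo_functor :> Functor E E';
  fo_ob : forall X : E, Q (fo_functor X) = P X;
  fo_hom : forall (X Y : E) (f : Hom X Y),
    Arrow (fmap Q (fmap fo_functor f)) = Arrow (fmap P f)
}.

Definition preserves_opcartesian (E E' B : Category) (P : Functor E B)
    (Q : Functor E' B) (F : FunctorOver P Q) : Prop :=
  forall (X Y : E) (f : Hom X Y), opcartesian P f -> opcartesian Q (fmap F f).

Record PbOb (E E' B : Category) (P : Functor E B) (Q : Functor E' B) := MkPbOb {
  pb_fst : E; pb_snd : E'; pb_eq : P pb_fst = Q pb_snd
}.

Record PbHom (E E' B : Category) (P : Functor E B) (Q : Functor E' B)
    (X Y : PbOb P Q) := MkPbHom {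
  pbh_fst : Hom (pb_fst X) (pb_fst Y);
  pbh_snd : Hom (pb_snd X) (pb_snd Y);
  pbh_eq : Arrow (fmap P pbh_fst) = Arrow (fmap Q pbh_snd)
}.

Lemma PbHom_ext (E E' B : Category) (P : Functor E B) (Q : Functor E' B)
  (X Y : PbOb P Q) (f g : PbHom X Y) :
  pbh_fst f = pbh_fst g -> pbh_snd f = pbh_snd g -> f = g.
Proof.
destruct f as [f1 f2 Hf], g as [g1 g2 Hg]; simpl; intros; subst.
f_equal; apply proof_irrelevance.
Qed.

Definition Pullback (E E' B : Category) (P : Functor E B) (Q : Functor E' B) :
  Category.
Proof.
refine {| Ob := PbOb P Q;
          Hom := fun X Y => PbHom X Y;
          idm := fun X => @MkPbHom _ _ _ P Q X X (idm _) (idm _) _;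
          comp := fun X Y Z g f => @MkPbHom _ _ _ P Q X Z
            (pbh_fst g ∘ pbh_fst f) (pbh_snd g ∘ pbh_snd f) _ |}.
Unshelve.
- intros X Y f; apply PbHom_ext; apply comp_id_l.
- intros X Y f; apply PbHom_ext; apply comp_id_r.
- intros W X Y Z h g f; apply PbHom_ext; apply comp_assoc.
- rewrite !fmap_id; apply Arrow_id, pb_eq.
- rewrite !fmap_comp; apply Arrow_comp; apply pbh_eq.
Defined.

Definition pullback_proj (E E' B : Category) (P : Functor E B)
  (Q : Functor E' B) : Functor (Pullback P Q) B.
Proof.
refine {| fob := fun X : Pullback P Q => P (pb_fst X);
          fmap := fun X Y (f : Hom X Y) => fmap P (pbh_fst f) |}.
- intros X; apply fmap_id.
- intros X Y Z g f; apply fmap_comp.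
Defined.

Record TensorData (E B : Category) (P : Functor E B) := {
  tensor : FunctorOver (pullback_proj P P) P;
  unit_section : FunctorOver (functor_id B) P
}.

Definition pair_ob (E B : Category) (P : Functor E B) (A : B) (X Y : Fib P A) :
    Pullback P P :=
  MkPbOb (eq_trans (fib_over X) (eq_sym (fib_over Y))).

Definition pair_hom (E B : Category) (P : Functor E B) (A A' : B) (u : Hom A A')
    (X Y : Fib P A) (X' Y' : Fib P A') (f : HomOver u X X') (g : HomOver u Y Y') :
    Hom (pair_ob X Y) (pair_ob X' Y') :=
  @MkPbHom _ _ _ P P (pair_ob X Y) (pair_ob X' Y') (hom_of f) (hom_of g)
    (eq_trans (hom_over f) (eq_sym (hom_over g))).

Definition otimes (E B : Category) (P : Functor E B) (T : TensorData P)
    (A : B) (X Y : Fib P A) : Fib P A :=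
  @MkFib E B P A (tensor T (pair_ob X Y))
    (eq_trans (fo_ob (tensor T) (pair_ob X Y)) (fib_over X)).

Definition otimes_hom (E B : Category) (P : Functor E B) (T : TensorData P)
    (A A' : B) (u : Hom A A') (X Y : Fib P A) (X' Y' : Fib P A')
    (f : HomOver u X X') (g : HomOver u Y Y') :
    HomOver u (otimes T X Y) (otimes T X' Y') :=
  @MkHomOver E B P A A' u (otimes T X Y) (otimes T X' Y')
    (fmap (tensor T) (pair_hom f g))
    (eq_trans (fo_hom (tensor T) (pair_hom f g)) (hom_over f)).

Definition unit_ob (E B : Category) (P : Functor E B) (T : TensorData P) (A : B) :
    Fib P A :=
  MkFib (P := P) (fo_ob (unit_section T) A).

Definition unit_hom (E B : Category) (P : Functor E B) (T : TensorData P)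
    (A A' : B) (u : Hom A A') : HomOver u (unit_ob T A) (unit_ob T A') :=
  @MkHomOver E B P A A' u (unit_ob T A) (unit_ob T A')
    (fmap (unit_section T) u) (fo_hom (unit_section T) u).

(** [otimes], [otimes_hom] and [unit_ob], retyped so that [Hom], [idm] and [∘]
    are those of the category [Fibre P A]. *)
Definition ftens (E B : Category) (P : Functor E B) (T : TensorData P) (A : B)
    (X Y : Fibre P A) : Fibre P A :=
  otimes T X Y.

Definition ftens_hom (E B : Category) (P : Functor E B) (T : TensorData P)
    (A : B) (X X' Y Y' : Fibre P A) (f : Hom X X') (g : Hom Y Y') :
    Hom (ftens T X Y) (ftens T X' Y') :=
  otimes_hom T f g.

Definition funit (E B : Category) (P : Functor E B) (T : TensorData P) (A : B) :
    Fibre P A :=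
  unit_ob T A.

(** The associator and the unitors are given by their components, which are
    isomorphisms of the fibres, and are natural with respect to all morphisms
    of [E] over a common morphism [u] of [B]. *)
Record MonoidalOpfibration (E B : Category) (P : Functor E B) := {
  mo_data :> TensorData P;
  mo_opfibration : is_opfibration P;
  mo_tensor_opcartesian : preserves_opcartesian (tensor mo_data);
  mo_unit_opcartesian : preserves_opcartesian (unit_section mo_data);
  mo_assoc : forall (A : B) (X Y Z : Fibre P A),
    Hom (ftens mo_data (ftens mo_data X Y) Z)
        (ftens mo_data X (ftens mo_data Y Z));
  mo_lunit : forall (A : B) (X : Fibre P A),
    Hom (ftens mo_data (funit mo_data A) X) X;
  mo_runit : forall (A : B) (X : Fibre P A),
    Hom (ftens mo_data X (funit mo_data A)) X;
  mo_assoc_iso : forall (A : B) (X Y Z : Fibre P A), is_iso (mo_assoc X Y Z);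
  mo_lunit_iso : forall (A : B) (X : Fibre P A), is_iso (mo_lunit X);
  mo_runit_iso : forall (A : B) (X : Fibre P A), is_iso (mo_runit X);
  mo_assoc_nat : forall (A A' : B) (u : Hom A A')
      (X Y Z : Fib P A) (X' Y' Z' : Fib P A')
      (f : HomOver u X X') (g : HomOver u Y Y') (h : HomOver u Z Z'),
    hom_of (mo_assoc X' Y' Z')
      ∘ hom_of (otimes_hom mo_data (otimes_hom mo_data f g) h)
    = hom_of (otimes_hom mo_data f (otimes_hom mo_data g h))
      ∘ hom_of (mo_assoc X Y Z);
  mo_lunit_nat : forall (A A' : B) (u : Hom A A') (X : Fib P A) (X' : Fib P A')
      (f : HomOver u X X'),
    hom_of (mo_lunit X') ∘ hom_of (otimes_hom mo_data (unit_hom mo_data u) f)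
    = hom_of f ∘ hom_of (mo_lunit X);
  mo_runit_nat : forall (A A' : B) (u : Hom A A') (X : Fib P A) (X' : Fib P A')
      (f : HomOver u X X'),
    hom_of (mo_runit X') ∘ hom_of (otimes_hom mo_data f (unit_hom mo_data u))
    = hom_of f ∘ hom_of (mo_runit X);
  mo_pentagon : forall (A : B) (W X Y Z : Fibre P A),
    mo_assoc W X (ftens mo_data Y Z) ∘ mo_assoc (ftens mo_data W X) Y Z
    = ftens_hom mo_data (idm W) (mo_assoc X Y Z)
        ∘ mo_assoc W (ftens mo_data X Y) Z
        ∘ ftens_hom mo_data (mo_assoc W X Y) (idm Z);
  mo_triangle : forall (A : B) (X Y : Fibre P A),
    ftens_hom mo_data (idm X) (mo_lunit Y) ∘ mo_assoc X (funit mo_data A) Y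
    = ftens_hom mo_data (mo_runit X) (idm Y)
}.

Record OpfibrationSymmetry (E B : Category) (P : Functor E B)
    (O : MonoidalOpfibration P) := {
  os_braid : forall (A : B) (X Y : Fibre P A), Hom (ftens O X Y) (ftens O Y X);
  os_nat : forall (A A' : B) (u : Hom A A') (X Y : Fib P A) (X' Y' : Fib P A')
      (f : HomOver u X X') (g : HomOver u Y Y'),
    hom_of (os_braid X' Y') ∘ hom_of (otimes_hom O f g)
    = hom_of (otimes_hom O g f) ∘ hom_of (os_braid X Y);
  os_invol : forall (A : B) (X Y : Fibre P A),
    os_braid Y X ∘ os_braid X Y = idm (ftens O X Y);
  os_hexagon : forall (A : B) (X Y Z : Fibre P A),
    mo_assoc O Y Z X ∘ os_braid X (ftens O Y Z) ∘ mo_assoc O X Y Z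
    = ftens_hom O (idm Y) (os_braid X Z) ∘ mo_assoc O Y X Z
        ∘ ftens_hom O (os_braid X Y) (idm Z)
}.

Lemma ftens_id (E B : Category) (P : Functor E B) (T : TensorData P) (A : B)
  (X Y : Fibre P A) :
  ftens_hom T (idm X) (idm Y) = idm (ftens T X Y).
Proof.
apply HomOver_eq; cbn.
rewrite <- fmap_id; apply f_equal; apply PbHom_ext; reflexivity.
Qed.

Lemma ftens_comp (E B : Category) (P : Functor E B) (T : TensorData P) (A : B)
  (X X' X'' Y Y' Y'' : Fibre P A) (f' : Hom X' X'') (f : Hom X X')
  (g' : Hom Y' Y'') (g : Hom Y Y') :
  ftens_hom T (f' ∘ f) (g' ∘ g) = ftens_hom T f' g' ∘ ftens_hom T f g.
Proof.
apply HomOver_eq; cbn.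
rewrite <- fmap_comp; apply f_equal; apply PbHom_ext; reflexivity.
Qed.

Lemma unit_hom_id (E B : Category) (P : Functor E B) (T : TensorData P) (A : B) :
  unit_hom T (idm A) = idm (funit T A).
Proof. apply HomOver_eq; cbn; apply (fmap_id (unit_section T)). Qed.

Lemma unit_hom_comp (E B : Category) (P : Functor E B) (T : TensorData P)
  (A A' A'' : B) (v : Hom A' A'') (u : Hom A A') :
  hom_of (unit_hom T (v ∘ u)) = hom_of (unit_hom T v) ∘ hom_of (unit_hom T u).
Proof. cbn; apply (fmap_comp (unit_section T)). Qed.

Definition fibre_monoidal (E B : Category) (P : Functor E B)
  (O : MonoidalOpfibration P) (A : B) : MonoidalCategory.
Proof.
refine {| mcat := Fibre P A;
          mtens := fun X Y => ftens O X Y;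
          mtens_hom := fun X X' Y Y' f g => ftens_hom O f g;
          munit := funit O A;
          massoc := fun X Y Z => mo_assoc O X Y Z;
          mlunit := fun X => mo_lunit O X;
          mrunit := fun X => mo_runit O X |}.
- intros X Y; apply ftens_id.
- intros; apply ftens_comp.
- intros; apply HomOver_eq; cbn; apply mo_assoc_nat.
- intros; apply HomOver_eq; rewrite <- unit_hom_id; cbn; apply mo_lunit_nat.
- intros; apply HomOver_eq; rewrite <- unit_hom_id; cbn; apply mo_runit_nat.
- intros; apply mo_assoc_iso.
- intros; apply mo_lunit_iso.
- intros; apply mo_runit_iso.
- intros; apply mo_pentagon.
- intros; apply mo_triangle.
Defined.

Definition fibre_symmetry (E B : Category) (P : Functor E B)
  (O : MonoidalOpfibration P) (S : OpfibrationSymmetry O) (A : B) :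
  Symmetry (fibre_monoidal O A).
Proof.
refine (@Build_Symmetry (fibre_monoidal O A) (fun X Y => os_braid S X Y) _ _ _).
- intros; apply HomOver_eq; cbn; apply os_nat.
- intros; apply os_invol.
- intros; apply os_hexagon.
Defined.

(** A monoid in a fibre is an object [R] of [E] with a monoid structure in the
    fibre over [P R]. *)
Record FibMonoid (E B : Category) (P : Functor E B) (O : MonoidalOpfibration P) :=
  MkFibMonoid {
    fm_ob :> Ob E;
    fm_str : @Monoid (fibre_monoidal O (P fm_ob)) (self P fm_ob)
  }.

Record FibMonoidHom (E B : Category) (P : Functor E B)
    (O : MonoidalOpfibration P) (R S : FibMonoid O) := MkFibMonoidHom {
  fmh : Hom (fm_ob R) (fm_ob S);
  fmh_mul : hom_of (mon_mul (fm_str S))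
              ∘ hom_of (otimes_hom O (self_hom P fmh) (self_hom P fmh))
            = fmh ∘ hom_of (mon_mul (fm_str R));
  fmh_one : hom_of (mon_one (fm_str S)) ∘ hom_of (unit_hom O (fmap P fmh))
            = fmh ∘ hom_of (mon_one (fm_str R))
}.

Lemma FibMonoidHom_eq (E B : Category) (P : Functor E B)
  (O : MonoidalOpfibration P) (R S : FibMonoid O) (f g : FibMonoidHom R S) :
  fmh f = fmh g -> f = g.
Proof.
destruct f as [f f1 f2], g as [g g1 g2]; simpl; intros e; subst g.
f_equal; apply proof_irrelevance.
Qed.

Lemma otimes_hom_ext (E B : Category) (P : Functor E B) (T : TensorData P)
  (A A' : B) (u v : Hom A A') (X Y : Fib P A) (X' Y' : Fib P A')
  (f : HomOver u X X') (g : HomOver u Y Y')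
  (f' : HomOver v X X') (g' : HomOver v Y Y') :
  hom_of f = hom_of f' -> hom_of g = hom_of g' ->
  hom_of (otimes_hom T f g) = hom_of (otimes_hom T f' g').
Proof.
intros ef eg; cbn; apply f_equal; apply PbHom_ext; assumption.
Qed.

Lemma otimes_over_comp (E B : Category) (P : Functor E B) (T : TensorData P)
  (A A' A'' : B) (v : Hom A' A'') (u : Hom A A') (X Y : Fib P A)
  (X' Y' : Fib P A') (X'' Y'' : Fib P A'')
  (f' : HomOver v X' X'') (f : HomOver u X X')
  (g' : HomOver v Y' Y'') (g : HomOver u Y Y') :
  hom_of (otimes_hom T (over_compose f' f) (over_compose g' g))
  = hom_of (otimes_hom T f' g') ∘ hom_of (otimes_hom T f g).
Proof.
cbn; rewrite <- fmap_comp; apply f_equal; apply PbHom_ext; reflexivity.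
Qed.

Lemma otimes_over_id (E B : Category) (P : Functor E B) (T : TensorData P)
  (A : B) (u : Hom A A) (X Y : Fib P A) (f : HomOver u X X) (g : HomOver u Y Y) :
  hom_of f = idm _ -> hom_of g = idm _ ->
  hom_of (otimes_hom T f g) = idm _.
Proof.
intros ef eg; cbn.
rewrite <- fmap_id; apply f_equal; apply PbHom_ext; assumption.
Qed.

Definition fmh_id (E B : Category) (P : Functor E B)
  (O : MonoidalOpfibration P) (R : FibMonoid O) : FibMonoidHom R R.
Proof.
refine (@MkFibMonoidHom E B P O R R (idm _) _ _).
- rewrite otimes_over_id by reflexivity.
  rewrite comp_id_l; apply comp_id_r.
- rewrite fmap_id, unit_hom_id; cbn; rewrite comp_id_l; apply comp_id_r.
Defined.

Definition fmh_comp (E B : Category) (P : Functor E B)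
  (O : MonoidalOpfibration P) (R S T : FibMonoid O)
  (g : FibMonoidHom S T) (f : FibMonoidHom R S) : FibMonoidHom R T.
Proof.
refine (@MkFibMonoidHom E B P O R T (fmh g ∘ fmh f) _ _).
- rewrite (otimes_hom_ext O
    (f' := over_compose (self_hom P (fmh g)) (self_hom P (fmh f)))
    (g' := over_compose (self_hom P (fmh g)) (self_hom P (fmh f))))
    by reflexivity.
  rewrite otimes_over_comp, comp_assoc, fmh_mul, <- !comp_assoc, fmh_mul.
  reflexivity.
- rewrite fmap_comp, unit_hom_comp, comp_assoc, fmh_one, <- !comp_assoc, fmh_one.
  reflexivity.
Defined.

Definition Mon (E B : Category) (P : Functor E B) (O : MonoidalOpfibration P) :
  Category.
Proof.
refine {| Ob := FibMonoid O;
          Hom := fun R S => FibMonoidHom R S;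
          idm := fun R => fmh_id R;
          comp := fun R S T g f => fmh_comp g f |}.
- intros X Y f; apply FibMonoidHom_eq, comp_id_l.
- intros X Y f; apply FibMonoidHom_eq, comp_id_r.
- intros W X Y Z h g f; apply FibMonoidHom_eq, comp_assoc.
Defined.

Definition Mon_base (E B : Category) (P : Functor E B)
  (O : MonoidalOpfibration P) : Functor (Mon O) B.
Proof.
refine {| fob := fun R : Mon O => P (fm_ob R);
          fmap := fun R S (f : Hom R S) => fmap P (fmh f) |}.
- intros R; apply fmap_id.
- intros R S T g f; apply fmap_comp.
Defined.

Record FibModule (E B : Category) (P : Functor E B) (O : MonoidalOpfibration P) :=
  MkFibModule {
    md_mon : FibMonoid O;
    md_ob : Fib P (P md_mon);
    md_str : @RightModule (fibre_monoidal O (P md_mon)) (self P md_mon)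
               (fm_str md_mon) md_ob
  }.

(** The condition [P φ = P α] on a pair [(φ, α)] is the fact that [α] lies over
    [P φ]. *)
Record FibModuleHom (E B : Category) (P : Functor E B)
    (O : MonoidalOpfibration P) (M N : FibModule O) := MkFibModuleHom {
  mdh_mon : FibMonoidHom (md_mon M) (md_mon N);
  mdh_map : HomOver (fmap P (fmh mdh_mon)) (md_ob M) (md_ob N);
  mdh_act : hom_of (act (md_str N))
              ∘ hom_of (otimes_hom O mdh_map (self_hom P (fmh mdh_mon)))
            = hom_of mdh_map ∘ hom_of (act (md_str M))
}.

Lemma FibModuleHom_eq (E B : Category) (P : Functor E B)
  (O : MonoidalOpfibration P) (M N : FibModule O) (f g : FibModuleHom M N) :
  mdh_mon f = mdh_mon g -> hom_of (mdh_map f) = hom_of (mdh_map g) -> f = g.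
Proof.
destruct f as [f a Hf], g as [g b Hg]; simpl; intros e e'; subst g.
apply HomOver_eq in e'; subst b.
f_equal; apply proof_irrelevance.
Qed.

Definition mdh_id (E B : Category) (P : Functor E B)
  (O : MonoidalOpfibration P) (M : FibModule O) : FibModuleHom M M.
Proof.
unshelve refine (@MkFibModuleHom E B P O M M (fmh_id (md_mon M))
  (@MkHomOver E B P _ _ _ (md_ob M) (md_ob M) (idm _) _) _).
- cbn; rewrite over_id, fmap_id; reflexivity.
- rewrite otimes_over_id by reflexivity.
  rewrite comp_id_r; symmetry; apply comp_id_l.
Defined.

Definition mdh_comp (E B : Category) (P : Functor E B)
  (O : MonoidalOpfibration P) (L M N : FibModule O)
  (g : FibModuleHom M N) (f : FibModuleHom L M) : FibModuleHom L N.
Proof.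
unshelve refine (@MkFibModuleHom E B P O L N
  (fmh_comp (mdh_mon g) (mdh_mon f))
  (@MkHomOver E B P _ _ _ (md_ob L) (md_ob N)
     (hom_of (mdh_map g) ∘ hom_of (mdh_map f)) _) _).
- cbn; rewrite over_comp, <- fmap_comp; reflexivity.
- rewrite (otimes_hom_ext O
    (f' := over_compose (mdh_map g) (mdh_map f))
    (g' := over_compose (self_hom P (fmh (mdh_mon g)))
                        (self_hom P (fmh (mdh_mon f)))))
    by reflexivity.
  rewrite otimes_over_comp, comp_assoc, mdh_act.
  cbn [hom_of]; rewrite <- !comp_assoc, mdh_act; reflexivity.
Defined.

Definition Mod (E B : Category) (P : Functor E B) (O : MonoidalOpfibration P) :
  Category.
Proof.
refine {| Ob := FibModule O;
          Hom := fun M N => FibModuleHom M N;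
          idm := fun M => mdh_id M;
          comp := fun L M N g f => mdh_comp g f |}.
- intros X Y f; apply FibModuleHom_eq;
    [apply FibMonoidHom_eq, comp_id_l | apply comp_id_l].
- intros X Y f; apply FibModuleHom_eq;
    [apply FibMonoidHom_eq, comp_id_r | apply comp_id_r].
- intros W X Y Z h g f; apply FibModuleHom_eq;
    [apply FibMonoidHom_eq, comp_assoc | apply comp_assoc].
Defined.

Definition Mod_Mon (E B : Category) (P : Functor E B)
    (O : MonoidalOpfibration P) : Functor (Mod O) (Mon O) :=
  @Build_Functor (Mod O) (Mon O) (fun M => md_mon M) (fun M N f => mdh_mon f)
    (fun _ => eq_refl) (fun _ _ _ _ _ => eq_refl).

Definition FullSubcategory (C : Category) (Q : C -> Prop) : Category :=
  {| Ob := {X : C | Q X};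
     Hom := fun X Y => Hom (proj1_sig X) (proj1_sig Y);
     idm := fun X => idm (proj1_sig X);
     comp := fun X Y Z g f => g ∘ f;
     comp_id_l := fun X Y f => comp_id_l f;
     comp_id_r := fun X Y f => comp_id_r f;
     comp_assoc := fun W X Y Z h g f => comp_assoc h g f |}.

Definition is_comm (E B : Category) (P : Functor E B)
    (O : MonoidalOpfibration P) (S : OpfibrationSymmetry O) (R : Mon O) : Prop :=
  commutative (fibre_symmetry S (P (fm_ob R))) (fm_str R).

Definition Comm (E B : Category) (P : Functor E B)
    (O : MonoidalOpfibration P) (S : OpfibrationSymmetry O) : Category :=
  FullSubcategory (is_comm S).

Definition Comm_base (E B : Category) (P : Functor E B)
  (O : MonoidalOpfibration P) (S : OpfibrationSymmetry O) : Functor (Comm S) B.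
Proof.
refine {| fob := fun R : Comm S => Mon_base O (proj1_sig R);
          fmap := fun R R' (f : Hom R R') => fmap (Mon_base O) f |}.
- intros R; apply (fmap_id (Mon_base O)).
- intros R R' R'' g f; apply (fmap_comp (Mon_base O)).
Defined.

Definition Modc (E B : Category) (P : Functor E B)
    (O : MonoidalOpfibration P) (S : OpfibrationSymmetry O) : Category :=
  FullSubcategory (fun M : Mod O => is_comm S (md_mon M)).

Definition Modc_Comm (E B : Category) (P : Functor E B)
    (O : MonoidalOpfibration P) (S : OpfibrationSymmetry O) :
    Functor (Modc S) (Comm S) :=
  @Build_Functor (Modc S) (Comm S)
    (fun M => exist (is_comm S) (md_mon (proj1_sig M)) (proj2_sig M))
    (fun M N (f : FibModuleHom (proj1_sig M) (proj1_sig N)) => mdh_mon f)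
    (fun _ => eq_refl) (fun _ _ _ _ _ => eq_refl).

(* Main.v *)
Require Import Defs.
From Stdlib Require Import IndefiniteDescription.

Set Implicit Arguments.
Unset Strict Implicit.
Unset Printing Implicit Defensive.

(** Since [⊗] and [I] preserve opcartesian arrows, an opcartesian lift
    [g : R -> u_* R] induces opcartesian arrows [g ⊗ g], [(g ⊗ g) ⊗ g] and
    [I(u)], along which the monoid structure of [R] and its axioms are carried
    to [u_* R]; so [Mon(P)] is an opfibration over [B].

    Given a monoid morphism [f : R -> S] over [u] and an [R]-module [M], the lift
    of [f] is the relative tensor product of [u_* M] with [S], computed without
    passing through [u_* R]: it is the reflexive coequalizer of the two [S]-linear
    maps [u_*(M ⊗ R) ⊗ S -> u_* M ⊗ S] that extend
    [u_*(M ⊗ R) -> u_* M -> u_* M ⊗ S] (action, then unit of [S]) and the map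
    induced by [M ⊗ R -> u_* M ⊗ S], the lift of [M] tensored with [f].  As
    [- ⊗ S] preserves it, it is an [S]-module; as the [w_*] preserve it, it is
    also universal for arrows over a nonidentity [w]. *)

(** * Cancellation of isomorphisms and coequalizers *)

Definition iso_inv (C : Category) (X Y : C) (f : Hom X Y) (i : is_iso f) :
  Hom Y X := proj1_sig (constructive_indefinite_description _ i).

Lemma iso_inv_l (C : Category) (X Y : C) (f : Hom X Y) (i : is_iso f) :
  iso_inv i ∘ f = idm X.
Proof. exact (proj1 (proj2_sig (constructive_indefinite_description _ i))). Qed.

Lemma iso_inv_r (C : Category) (X Y : C) (f : Hom X Y) (i : is_iso f) :
  f ∘ iso_inv i = idm Y.
Proof. exact (proj2 (proj2_sig (constructive_indefinite_description _ i))). Qed.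

Lemma iso_epi (C : Category) (X Y Z : C) (f : Hom X Y) (g h : Hom Y Z) :
  is_iso f -> g ∘ f = h ∘ f -> g = h.
Proof.
intros [f' [_ e]] H.
rewrite <- (comp_id_r g), <- (comp_id_r h), <- e, !comp_assoc, H; reflexivity.
Qed.

Lemma iso_mono (C : Category) (X Y Z : C) (f : Hom Y Z) (g h : Hom X Y) :
  is_iso f -> f ∘ g = f ∘ h -> g = h.
Proof.
intros [f' [e _]] H.
rewrite <- (comp_id_l g), <- (comp_id_l h), <- e, <- !comp_assoc, H; reflexivity.
Qed.

Lemma coequalizer_epi (C : Category) (X Y Q Z : C) (f g : Hom X Y)
  (q : Hom Y Q) (h k : Hom Q Z) :
  is_coequalizer f g q -> h ∘ q = k ∘ q -> h = k.
Proof.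
intros [e U] H.
destruct (U Z (h ∘ q)) as [l [_ Hl]].
{ rewrite <- !comp_assoc, e; reflexivity. }
rewrite <- (Hl h eq_refl); apply Hl; symmetry; exact H.
Qed.

Lemma fmap_reflexive_pair (C D : Category) (F : Functor C D) (X Y : C)
  (f g : Hom X Y) : reflexive_pair f g -> reflexive_pair (fmap F f) (fmap F g).
Proof.
intros [s [ef eg]]; exists (fmap F s).
rewrite <- !fmap_comp, ef, eg, fmap_id; split; reflexivity.
Qed.

(** * Free modules and coequalizers of modules in a monoidal category *)

Lemma mtens_comp_l (V : MonoidalCategory) (X X' X'' Y : V) (f' : Hom X' X'')
  (f : Hom X X') :
  mtens_hom (f' ∘ f) (idm Y) = mtens_hom f' (idm Y) ∘ mtens_hom f (idm Y).
Proof. rewrite <- mtens_comp, comp_id_l; reflexivity. Qed.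

Lemma mtens_comp_r (V : MonoidalCategory) (X Y Y' Y'' : V) (f' : Hom Y' Y'')
  (f : Hom Y Y') :
  mtens_hom (idm X) (f' ∘ f) = mtens_hom (idm X) f' ∘ mtens_hom (idm X) f.
Proof. rewrite <- mtens_comp, comp_id_l; reflexivity. Qed.

Lemma mtens_swap (V : MonoidalCategory) (X X' Y Y' : V) (f : Hom X X')
  (g : Hom Y Y') :
  mtens_hom (idm X') g ∘ mtens_hom f (idm Y)
  = mtens_hom f (idm Y') ∘ mtens_hom (idm X) g.
Proof. rewrite <- !mtens_comp, !comp_id_l, !comp_id_r; reflexivity. Qed.

(** Naturality of the right unitor makes [- ⊗ I] isomorphic to the identity functor. *)
Lemma tensor_unit_faithful (V : MonoidalCategory) (X Y : V) (f g : Hom X Y) :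
  mtens_hom f (idm munit) = mtens_hom g (idm munit) -> f = g.
Proof.
intros H; apply (iso_epi (mrunit_iso X)).
rewrite <- !mrunit_nat, H; reflexivity.
Qed.

(* Kelly's redundant triangle: after tensoring with the unit it follows from the
   pentagon at [X, Y, I, I] and two instances of [mtriangle]. *)
Lemma mrunit_tensor (V : MonoidalCategory) (X Y : V) :
  mtens_hom (idm X) (mrunit Y) ∘ massoc X Y munit = mrunit (mtens X Y).
Proof.
apply tensor_unit_faithful, (iso_mono (massoc_iso X Y munit)).
rewrite mtens_comp_l, comp_assoc, massoc_nat, <- (mtriangle Y), mtens_comp_r.
rewrite <- (mtriangle (mtens X Y)), comp_assoc, <- (mtens_id X Y), massoc_nat.
rewrite <- !comp_assoc.
f_equal; rewrite comp_assoc; symmetry; apply mpentagon.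
Qed.

Definition free_module (V : MonoidalCategory) (S : V) (m : Monoid S) (X : V) :
  RightModule m (mtens X S).
Proof.
refine {| act := mtens_hom (idm X) (mon_mul m) ∘ massoc X S S |}.
- rewrite mtens_comp_l, comp_assoc, <- (comp_assoc _ (massoc X S S)).
  rewrite massoc_nat, (comp_assoc (mtens_hom _ _) (mtens_hom _ _)).
  rewrite <- mtens_comp_r, mon_assoc.
  rewrite <- (mtens_id X S), <- (comp_assoc _ (massoc X S S)), massoc_nat.
  rewrite !mtens_comp_r, <- !comp_assoc.
  (* After associativity of the multiplication, what remains is the pentagon at [X], [S], [S],
     [S]. *)
  do 2 f_equal; rewrite comp_assoc; symmetry; apply mpentagon.
- rewrite <- (mtens_id X S), <- comp_assoc, massoc_nat, comp_assoc.
  rewrite <- mtens_comp_r, mon_one_r; apply mrunit_tensor.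
Defined.

(** The unit of the adjunction between free modules and the forgetful functor; [free_extend] below
    is the transpose of [f]. *)
Definition free_unit (V : MonoidalCategory) (S : V) (m : Monoid S) (X : V) :
  Hom X (mtens X S) :=
  mtens_hom (idm X) (mon_one m) ∘ iso_inv (mrunit_iso X).

Lemma free_unit_mrunit (V : MonoidalCategory) (S : V) (m : Monoid S) (X : V) :
  free_unit m X ∘ mrunit X = mtens_hom (idm X) (mon_one m).
Proof. unfold free_unit; rewrite <- comp_assoc, iso_inv_l; apply comp_id_r. Qed.

Lemma act_free_unit (V : MonoidalCategory) (S : V) (m : Monoid S) (N : V)
  (n : RightModule m N) : act n ∘ free_unit m N = idm N.
Proof.
unfold free_unit; rewrite comp_assoc, act_one; apply iso_inv_r.
Qed.

Definition free_extend (V : MonoidalCategory) (S : V) (m : Monoid S) (W N : V)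
  (n : RightModule m N) (f : Hom W N) : Hom (mtens W S) N :=
  act n ∘ mtens_hom f (idm S).

Definition module_map (V : MonoidalCategory) (S : V) (m : Monoid S) (M N : V)
  (a : RightModule m M) (b : RightModule m N) (f : Hom M N) : Prop :=
  act b ∘ mtens_hom f (idm S) = f ∘ act a.

(** This is associativity of the action of [n], once [f] has been moved past the associator. *)
Lemma free_extend_map (V : MonoidalCategory) (S : V) (m : Monoid S) (W N : V)
  (n : RightModule m N) (f : Hom W N) :
  module_map (free_module m W) n (free_extend n f).
Proof.
unfold module_map, free_extend; cbn.
rewrite mtens_comp_l, comp_assoc, act_assoc, <- (comp_assoc _ (massoc N S S)).
rewrite massoc_nat, mtens_id, !comp_assoc, <- !(comp_assoc (act n)).
rewrite mtens_swap; reflexivity.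
Qed.

Lemma free_extend_unit (V : MonoidalCategory) (S : V) (m : Monoid S) (W N : V)
  (n : RightModule m N) (f : Hom W N) : free_extend n f ∘ free_unit m W = f.
Proof.
unfold free_extend, free_unit.
rewrite comp_assoc, <- (comp_assoc (act n)), <- mtens_swap, comp_assoc.
rewrite act_one, mrunit_nat, <- comp_assoc, iso_inv_r; apply comp_id_r.
Qed.

(** A triangle identity of the free-module adjunction: the left unit law of [S] followed by
    [mtriangle]. *)
Lemma free_extend_id (V : MonoidalCategory) (S : V) (m : Monoid S) (X : V) :
  free_extend (free_module m X) (free_unit m X) = idm (mtens X S).
Proof.
unfold free_extend, free_unit; cbn.
rewrite mtens_comp_l, comp_assoc, <- (comp_assoc _ (massoc X S S)), massoc_nat.
rewrite comp_assoc, <- mtens_comp_r, mon_one_l, mtriangle, <- mtens_comp_l.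
rewrite iso_inv_r; apply mtens_id.
Qed.

(** Since [q ⊗ S] is again a coequalizer, [q ∘ act b] descends to an action on [Q], and the module
    axioms follow by cancelling epimorphisms. *)
Lemma module_coequalizer (V : MonoidalCategory) (S : V) (m : Monoid S)
  (M N Q : V) (a : RightModule m M) (b : RightModule m N) (f g : Hom M N)
  (q : Hom N Q) :
  preserves_reflexive_coequalizers (tensor_right S) ->
  module_map a b f -> module_map a b g -> reflexive_pair f g ->
  is_coequalizer f g q ->
  exists d : RightModule m Q, module_map b d q.
Proof.
intros pS af ag r cq.
(* Tensoring keeps the pair reflexive, so preservation applies a second time and [(q ⊗ S) ⊗ S] is
   epi, as associativity requires. *)
pose proof (fmap_reflexive_pair (tensor_right S) r) as r1.
pose proof (pS _ _ _ _ _ _ r cq) as cq1.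
pose proof (pS _ _ _ _ _ _ r1 cq1) as cq2.
cbn in r1, cq1, cq2.
destruct (proj2 cq1 _ (q ∘ act b)) as [k [ek _]].
{ rewrite <- !comp_assoc, af, ag, !comp_assoc, (proj1 cq); reflexivity. }
unshelve eexists (@Build_RightModule V S m Q k _ _).
- apply (coequalizer_epi cq2).
  rewrite <- comp_assoc, <- mtens_comp_l, ek, mtens_comp_l, comp_assoc, ek.
  rewrite <- comp_assoc, act_assoc.
  rewrite <- (comp_assoc _ (massoc Q S S)), massoc_nat, mtens_id.
  rewrite !comp_assoc, <- (comp_assoc k), mtens_swap, comp_assoc, ek.
  reflexivity.
(* Moving the unitor across turns the unit law into an equation between endomorphisms of [Q], which
   can be tested on [q]. *)
- rewrite <- (comp_id_r (k ∘ _)), <- (iso_inv_l (mrunit_iso Q)), comp_assoc.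
  rewrite <- (comp_id_l (mrunit Q)) at 3; f_equal.
  apply (coequalizer_epi cq).
  apply (iso_epi (mrunit_iso N)).
  rewrite comp_id_l, <- !(comp_assoc _ q), <- mrunit_nat.
  rewrite (comp_assoc _ (mrunit Q)), <- (comp_assoc _ (iso_inv _)).
  rewrite iso_inv_l, comp_id_r, <- comp_assoc, mtens_swap, comp_assoc, ek.
  rewrite <- comp_assoc, act_one, <- mrunit_nat; reflexivity.
- exact ek.
Qed.

(** * Opcartesian arrows, their pairs and their tensor products *)

Lemma opcartesian_epi (E B : Category) (P : Functor E B) (A A' A'' : B)
  (u : Hom A A') (w : Hom A' A'') (X : Fib P A) (Y : Fib P A') (Z : Fib P A'')
  (g : HomOver u X Y) (k k' : HomOver w Y Z) :
  opcartesian P (hom_of g) -> hom_of k ∘ hom_of g = hom_of k' ∘ hom_of g ->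
  k = k'.
Proof.
intros og e.
destruct (opcartesian_over (over_compose k g) og eq_refl) as [l [_ Hl]].
rewrite <- (Hl k eq_refl); apply Hl; symmetry; exact e.
Qed.

(** The composite is recorded over [u] itself, not over [idm A' ∘ u], so that it can be compared
    with other arrows over [u]; [pre_vertical] does the same on the other side. *)
Definition post_vertical (E B : Category) (P : Functor E B) (A A' : B)
  (u : Hom A A') (X : Fib P A) (Y Z : Fib P A') (k : HomOver (idm A') Y Z)
  (f : HomOver u X Y) : HomOver u X Z :=
  @MkHomOver E B P A A' u X Z (hom_of k ∘ hom_of f)
    (eq_trans (over_comp k f) (f_equal Arrow (comp_id_l u))).

Definition pre_vertical (E B : Category) (P : Functor E B) (A A' : B)
  (u : Hom A A') (X Y : Fib P A) (Z : Fib P A') (f : HomOver u Y Z)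
  (k : HomOver (idm A) X Y) : HomOver u X Z :=
  @MkHomOver E B P A A' u X Z (hom_of f ∘ hom_of k)
    (eq_trans (over_comp f k) (f_equal Arrow (comp_id_r u))).

Lemma opcartesian_factor (E B : Category) (P : Functor E B) (A A' : B)
  (u : Hom A A') (X : Fib P A) (Y Z : Fib P A')
  (g : HomOver u X Y) (h : HomOver u X Z) :
  opcartesian P (hom_of g) ->
  exists k : HomOver (idm A') Y Z, hom_of k ∘ hom_of g = hom_of h.
Proof.
intros og; destruct (opcartesian_over h og (comp_id_l u)) as [k [e _]].
exists k; exact e.
Qed.

(** Each component factors separately, and the two factors form an arrow of the pullback because
    both lie over the same [w]. *)
Lemma opcartesian_pair (E B : Category) (P : Functor E B) (A A' : B)
  (u : Hom A A') (X Y : Fib P A) (X' Y' : Fib P A')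
  (f : HomOver u X X') (g : HomOver u Y Y') :
  opcartesian P (hom_of f) -> opcartesian P (hom_of g) ->
  opcartesian (pullback_proj P P) (pair_hom f g).
Proof.
destruct X as [X eX], X' as [X' eX'], f as [f Hf]; cbn in *; subst A A'.
pose proof (Arrow_inj Hf) as eu; subst u; intros of og [Z1 Z2 eZ] [h1 h2 eh] w e; cbn in *.
destruct (of Z1 h1 w e) as [k1 [[e1 e1'] U1]].
(* Regarding [h2] as an arrow over [P h1] lets its factor be taken over the [w] used for [k1]. *)
pose (h2' := @MkHomOver E B P (P X) (P Z1) (fmap P h1) Y
               (MkFib (P := P) (eq_sym eZ)) h2 (eq_sym eh)).
destruct (opcartesian_over h2' og e) as [k2 [e2 U2]]; cbn in *.
pose proof (hom_over k2) as H2; cbn in H2.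
exists (@MkPbHom _ _ _ P P
  (@pair_ob E B P (P X') (MkFib eq_refl) Y') (MkPbOb eZ) k1 (hom_of k2)
  (eq_trans (f_equal Arrow e1) (eq_sym H2))).
split.
- split; [exact e1 | apply PbHom_ext; [exact e1' | exact e2]].
- intros [l1 l2 el] [E1 E2]; cbn in *.
  pose proof (f_equal (@pbh_fst _ _ _ _ _ _ _) E2) as E21.
  pose proof (f_equal (@pbh_snd _ _ _ _ _ _ _) E2) as E22; cbn in E21, E22.
  apply PbHom_ext; cbn; [apply U1; split; assumption|].
  exact (f_equal (@hom_of _ _ _ _ _ _ _ _)
    (U2 (@MkHomOver E B P _ _ w Y' (MkFib (P := P) (eq_sym eZ)) l2
           (eq_trans (eq_sym el) (f_equal Arrow E1))) E22)).
Qed.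

Lemma otimes_hom_opcartesian (E B : Category) (P : Functor E B)
  (O : MonoidalOpfibration P) (A A' : B) (u : Hom A A') (X Y : Fib P A)
  (X' Y' : Fib P A') (f : HomOver u X X') (g : HomOver u Y Y') :
  opcartesian P (hom_of f) -> opcartesian P (hom_of g) ->
  opcartesian P (hom_of (otimes_hom O f g)).
Proof.
intros of og; apply (mo_tensor_opcartesian (m := O)), opcartesian_pair; assumption.
Qed.

Lemma unit_hom_opcartesian (E B : Category) (P : Functor E B)
  (O : MonoidalOpfibration P) (A A' : B) (u : Hom A A') :
  opcartesian P (hom_of (unit_hom O u)).
Proof.
(* Every arrow of [B] is opcartesian for the identity functor of [B]. *)
apply (mo_unit_opcartesian (m := O)); intros Z h w e.
exists w; split; [split; [reflexivity | exact e]|].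
intros k [e' _]; symmetry; exact e'.
Qed.

(** * Calculus of arrows over varying base arrows *)

Lemma otimes_comp (E B : Category) (P : Functor E B) (T : TensorData P)
  (A A' A'' : B) (v : Hom A' A'') (u : Hom A A') (w : Hom A A'')
  (X Y : Fib P A) (X' Y' : Fib P A') (X'' Y'' : Fib P A'')
  (f' : HomOver v X' X'') (f : HomOver u X X') (f'' : HomOver w X X'')
  (g' : HomOver v Y' Y'') (g : HomOver u Y Y') (g'' : HomOver w Y Y'') :
  hom_of f' ∘ hom_of f = hom_of f'' -> hom_of g' ∘ hom_of g = hom_of g'' ->
  hom_of (otimes_hom T f' g') ∘ hom_of (otimes_hom T f g)
  = hom_of (otimes_hom T f'' g'').
Proof.
intros ef eg; rewrite <- otimes_over_comp; apply otimes_hom_ext; assumption.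
Qed.

(** The base arrows [v ∘ u] and [v1 ∘ u1] need not be convertible, because [tensor] only sees the
    underlying arrows of [E]. The typical use exchanges a vertical arrow with one over [u]. *)
Lemma otimes_square (E B : Category) (P : Functor E B) (T : TensorData P)
  (A A' A1 A'' : B) (v : Hom A' A'') (u : Hom A A') (v1 : Hom A1 A'')
  (u1 : Hom A A1) (X Y : Fib P A) (X' Y' : Fib P A') (X1 Y1 : Fib P A1)
  (X'' Y'' : Fib P A'')
  (f' : HomOver v X' X'') (f : HomOver u X X')
  (f1' : HomOver v1 X1 X'') (f1 : HomOver u1 X X1)
  (g' : HomOver v Y' Y'') (g : HomOver u Y Y')
  (g1' : HomOver v1 Y1 Y'') (g1 : HomOver u1 Y Y1) :
  hom_of f' ∘ hom_of f = hom_of f1' ∘ hom_of f1 ->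
  hom_of g' ∘ hom_of g = hom_of g1' ∘ hom_of g1 ->
  hom_of (otimes_hom T f' g') ∘ hom_of (otimes_hom T f g)
  = hom_of (otimes_hom T f1' g1') ∘ hom_of (otimes_hom T f1 g1).
Proof.
intros ef eg; rewrite <- !otimes_over_comp; apply otimes_hom_ext; assumption.
Qed.

(** The [v]-prefixed constants retype the structure of the monoidal categories
    [fibre_monoidal O A] as morphisms [HomOver (idm A)] between [Fib P A]
    objects: equations between arrows of [E] lying over different arrows of [B]
    can then be rewritten by syntactic matching. *)
Definition vid (E B : Category) (P : Functor E B) (A : B) (X : Fib P A) :
  HomOver (idm A) X X := MkHomOver (over_id X).

Lemma vid_swap (E B : Category) (P : Functor E B) (A A' : B) (u : Hom A A')
  (X : Fib P A) (Y : Fib P A') (f : HomOver u X Y) :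
  hom_of (vid Y) ∘ hom_of f = hom_of f ∘ hom_of (vid X).
Proof. cbn; rewrite comp_id_l, comp_id_r; reflexivity. Qed.

Definition vassoc (E B : Category) (P : Functor E B)
  (O : MonoidalOpfibration P) (A : B) (X Y Z : Fib P A) :
  HomOver (idm A) (otimes O (otimes O X Y) Z) (otimes O X (otimes O Y Z)) :=
  mo_assoc O X Y Z.

Definition vlunit (E B : Category) (P : Functor E B)
  (O : MonoidalOpfibration P) (A : B) (X : Fib P A) :
  HomOver (idm A) (otimes O (unit_ob O A) X) X := mo_lunit O X.

Definition vrunit (E B : Category) (P : Functor E B)
  (O : MonoidalOpfibration P) (A : B) (X : Fib P A) :
  HomOver (idm A) (otimes O X (unit_ob O A)) X := mo_runit O X.

Lemma vassoc_nat (E B : Category) (P : Functor E B)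
  (O : MonoidalOpfibration P) (A A' : B) (u : Hom A A')
  (X Y Z : Fib P A) (X' Y' Z' : Fib P A')
  (f : HomOver u X X') (g : HomOver u Y Y') (h : HomOver u Z Z') :
  hom_of (vassoc O X' Y' Z') ∘ hom_of (otimes_hom O (otimes_hom O f g) h)
  = hom_of (otimes_hom O f (otimes_hom O g h)) ∘ hom_of (vassoc O X Y Z).
Proof. apply mo_assoc_nat. Qed.

Lemma vlunit_nat (E B : Category) (P : Functor E B)
  (O : MonoidalOpfibration P) (A A' : B) (u : Hom A A') (X : Fib P A)
  (X' : Fib P A') (f : HomOver u X X') :
  hom_of (vlunit O X') ∘ hom_of (otimes_hom O (unit_hom O u) f)
  = hom_of f ∘ hom_of (vlunit O X).
Proof. apply mo_lunit_nat. Qed.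

Lemma vrunit_nat (E B : Category) (P : Functor E B)
  (O : MonoidalOpfibration P) (A A' : B) (u : Hom A A') (X : Fib P A)
  (X' : Fib P A') (f : HomOver u X X') :
  hom_of (vrunit O X') ∘ hom_of (otimes_hom O f (unit_hom O u))
  = hom_of f ∘ hom_of (vrunit O X).
Proof. apply mo_runit_nat. Qed.

Definition vmul (E B : Category) (P : Functor E B)
  (O : MonoidalOpfibration P) (R : FibMonoid O) :
  HomOver (idm (P R)) (otimes O (self P R) (self P R)) (self P R) :=
  mon_mul (fm_str R).

Definition vone (E B : Category) (P : Functor E B)
  (O : MonoidalOpfibration P) (R : FibMonoid O) :
  HomOver (idm (P R)) (unit_ob O (P R)) (self P R) := mon_one (fm_str R).

Lemma vmul_assoc (E B : Category) (P : Functor E B)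
  (O : MonoidalOpfibration P) (R : FibMonoid O) :
  hom_of (vmul R) ∘ hom_of (otimes_hom O (vmul R) (vid (self P R)))
  = hom_of (vmul R) ∘ (hom_of (otimes_hom O (vid (self P R)) (vmul R))
    ∘ hom_of (vassoc O (self P R) (self P R) (self P R))).
Proof.
rewrite comp_assoc.
exact (f_equal (@hom_of _ _ _ _ _ _ _ _) (mon_assoc (fm_str R))).
Qed.

Lemma vmul_one_l (E B : Category) (P : Functor E B)
  (O : MonoidalOpfibration P) (R : FibMonoid O) :
  hom_of (vmul R) ∘ hom_of (otimes_hom O (vone R) (vid (self P R)))
  = hom_of (vlunit O (self P R)).
Proof. exact (f_equal (@hom_of _ _ _ _ _ _ _ _) (mon_one_l (fm_str R))). Qed.

Lemma vmul_one_r (E B : Category) (P : Functor E B)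
  (O : MonoidalOpfibration P) (R : FibMonoid O) :
  hom_of (vmul R) ∘ hom_of (otimes_hom O (vid (self P R)) (vone R))
  = hom_of (vrunit O (self P R)).
Proof. exact (f_equal (@hom_of _ _ _ _ _ _ _ _) (mon_one_r (fm_str R))). Qed.

Lemma fmh_vmul (E B : Category) (P : Functor E B)
  (O : MonoidalOpfibration P) (R S : FibMonoid O) (f : FibMonoidHom R S) :
  hom_of (vmul S) ∘ hom_of (otimes_hom O (self_hom P (fmh f)) (self_hom P (fmh f)))
  = hom_of (self_hom P (fmh f)) ∘ hom_of (vmul R).
Proof. exact (fmh_mul f). Qed.

Lemma fmh_vone (E B : Category) (P : Functor E B)
  (O : MonoidalOpfibration P) (R S : FibMonoid O) (f : FibMonoidHom R S) :
  hom_of (vone S) ∘ hom_of (unit_hom O (fmap P (fmh f)))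
  = hom_of (self_hom P (fmh f)) ∘ hom_of (vone R).
Proof. exact (fmh_one f). Qed.

Lemma vertical_eq (E B : Category) (P : Functor E B) (A A' : B) (u : Hom A A')
  (X : Fib P A) (Y : Fib P A') (f g : HomOver u X Y) :
  f = g -> hom_of f = hom_of g.
Proof. intros []; reflexivity. Qed.

(** * Direct images of monoids *)

Lemma monoid_direct_image (E B : Category) (P : Functor E B)
  (O : MonoidalOpfibration P) (R : FibMonoid O) (Y : E) (g : Hom (fm_ob R) Y) :
  opcartesian P g ->
  exists m : @Monoid (fibre_monoidal O (P Y)) (self P Y),
    hom_of (mon_mul m)
      ∘ hom_of (otimes_hom O (self_hom P g) (self_hom P g))
    = g ∘ hom_of (mon_mul (fm_str R))
    /\ hom_of (mon_one m) ∘ hom_of (unit_hom O (fmap P g))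
       = g ∘ hom_of (mon_one (fm_str R)).
Proof.
intros og.
set (G := self_hom P g).
pose proof (@otimes_hom_opcartesian _ _ _ O _ _ _ _ _ _ _ G G og og) as og2.
pose proof (@unit_hom_opcartesian _ _ _ O _ _ (fmap P g)) as ogI.
destruct (opcartesian_factor (pre_vertical G (vmul R)) og2)
  as [mu emu].
destruct (opcartesian_factor (pre_vertical G (vone R)) ogI)
  as [eta eeta].
change (hom_of mu ∘ hom_of (otimes_hom O G G)
        = hom_of G ∘ hom_of (vmul R)) in emu.
change (hom_of eta ∘ hom_of (unit_hom O (fmap P g))
        = hom_of G ∘ hom_of (vone R)) in eeta.
unshelve eexists (@Build_Monoid (fibre_monoidal O (P Y)) (self P Y) mu eta _ _ _).
(* Each axiom is tested on the opcartesian arrow into its source, where it becomes the same axiom of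
   [R] followed by [G]. *)
- apply (opcartesian_epi (g := otimes_hom O (otimes_hom O G G) G)).
  { repeat apply otimes_hom_opcartesian; assumption. }
  change (hom_of mu ∘ hom_of (otimes_hom O mu (vid (self P Y)))
    ∘ hom_of (otimes_hom O (otimes_hom O G G) G)
    = hom_of mu ∘ hom_of (otimes_hom O (vid (self P Y)) mu)
      ∘ hom_of (vassoc O (self P Y) (self P Y) (self P Y))
      ∘ hom_of (otimes_hom O (otimes_hom O G G) G)).
  rewrite <- !comp_assoc, (vassoc_nat O G G G).
  rewrite (comp_assoc (hom_of (otimes_hom O (vid _) mu))).
  rewrite (otimes_square O emu (vid_swap G)), (otimes_square O (vid_swap G) emu).
  rewrite !comp_assoc, emu, <- !comp_assoc; f_equal.
  apply vmul_assoc.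
- apply (opcartesian_epi (g := otimes_hom O (unit_hom O (fmap P g)) G)).
  { repeat apply otimes_hom_opcartesian; assumption. }
  change (hom_of mu ∘ hom_of (otimes_hom O eta (vid (self P Y)))
    ∘ hom_of (otimes_hom O (unit_hom O (fmap P g)) G)
    = hom_of (vlunit O (self P Y))
      ∘ hom_of (otimes_hom O (unit_hom O (fmap P g)) G)).
  rewrite vlunit_nat, <- comp_assoc, (otimes_square O eeta (vid_swap G)).
  rewrite comp_assoc, emu, <- comp_assoc; f_equal; apply vmul_one_l.
- apply (opcartesian_epi (g := otimes_hom O G (unit_hom O (fmap P g)))).
  { repeat apply otimes_hom_opcartesian; assumption. }
  change (hom_of mu ∘ hom_of (otimes_hom O (vid (self P Y)) eta)
    ∘ hom_of (otimes_hom O G (unit_hom O (fmap P g)))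
    = hom_of (vrunit O (self P Y))
      ∘ hom_of (otimes_hom O G (unit_hom O (fmap P g)))).
  rewrite vrunit_nat, <- comp_assoc, (otimes_square O (vid_swap G) eeta).
  rewrite comp_assoc, emu, <- comp_assoc; f_equal; apply vmul_one_r.
- split; assumption.
Qed.

(** The factorization [k] found in [E] is automatically a monoid morphism: its two equations may be
    checked after the opcartesian arrows [F ⊗ F] and [I(P f)]. *)
Lemma fmh_opcartesian (E B : Category) (P : Functor E B)
  (O : MonoidalOpfibration P) (R S : FibMonoid O) (f : FibMonoidHom R S) :
  opcartesian P (fmh f) -> @opcartesian (Mon O) B (Mon_base O) R S f.
Proof.
intros og Z h w e; cbn in w, e.
destruct (og _ (fmh h) w e) as [k [[ek1 ek2] U]]; subst w.
set (F := self_hom P (fmh f)); set (K := self_hom P k).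
set (H := self_hom P (fmh h)).
assert (EK : hom_of K ∘ hom_of F = hom_of H) by exact ek2.
unshelve eexists (@MkFibMonoidHom E B P O S Z k _ _).
(* Both sides are packaged as arrows over [P k], the form in which [opcartesian_epi] can compare
   them. *)
- apply (vertical_eq (f := post_vertical (vmul Z) (otimes_hom O K K))
    (g := pre_vertical K (vmul S))).
  apply (opcartesian_epi (g := otimes_hom O F F)).
  { apply otimes_hom_opcartesian; exact og. }
  cbn [post_vertical pre_vertical hom_of].
  rewrite <- comp_assoc, (otimes_comp O EK EK), <- comp_assoc.
  unfold F, H; rewrite !fmh_vmul, comp_assoc; fold F K; rewrite EK; reflexivity.
- apply (vertical_eq
    (f := post_vertical (vone Z) (unit_hom O (fmap P k)))
    (g := pre_vertical K (vone S))).
  apply (opcartesian_epi (@unit_hom_opcartesian _ _ _ O _ _ (fmap P (fmh f)))).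
  cbn [post_vertical pre_vertical hom_of].
  rewrite <- comp_assoc, <- unit_hom_comp, e, <- comp_assoc.
  rewrite !fmh_vone, comp_assoc; fold F K; rewrite EK; reflexivity.
- split.
  + split; [reflexivity | apply FibMonoidHom_eq; exact ek2].
  + intros l [el1 el2]; apply FibMonoidHom_eq, U; split; [exact el1|].
    exact (f_equal (@fmh _ _ _ _ _ _) el2).
Qed.

(** Opcartesianness is asserted in [E] rather than in [Mon O], since this is what transports
    commutativity. *)
Lemma monoid_opcartesian_lift (E B : Category) (P : Functor E B)
  (O : MonoidalOpfibration P) (A' : B) (R : FibMonoid O)
  (u : Hom (P (fm_ob R)) A') :
  exists (S : FibMonoid O) (f : FibMonoidHom R S),
    Arrow (fmap P (fmh f)) = Arrow u /\ opcartesian P (fmh f).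
Proof.
destruct (mo_opfibration O u (self P R)) as [[Y eY] [[g Hg] og]].
cbn in *; subst A'.
destruct (monoid_direct_image og) as [m [em1 em2]].
exists (@MkFibMonoid E B P O Y m),
  (@MkFibMonoidHom E B P O R (MkFibMonoid m) g em1 em2).
split; assumption.
Qed.

Lemma Mon_base_opfibration (E B : Category) (P : Functor E B)
  (O : MonoidalOpfibration P) : is_opfibration (Mon_base O).
Proof.
intros A A' u [R eR]; cbn in eR; subst A.
destruct (monoid_opcartesian_lift u) as [S [f [Hf og]]].
assert (eS : P (fm_ob S) = A') by exact (f_equal (@tgt B) Hf).
exists (@MkFib (Mon O) B (Mon_base O) A' S eS).
exists (@MkHomOver (Mon O) B (Mon_base O) _ _ u
  (@MkFib (Mon O) B (Mon_base O) _ R eq_refl)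
  (@MkFib (Mon O) B (Mon_base O) A' S eS) f Hf).
apply fmh_opcartesian, og.
Qed.

(** The symmetry is natural along [F ⊗ F], so commutativity of [S] restricts along this opcartesian
    arrow to that of [R]. *)
Lemma is_comm_opcartesian (E B : Category) (P : Functor E B)
  (O : MonoidalOpfibration P) (Y : OpfibrationSymmetry O) (R S : FibMonoid O)
  (f : FibMonoidHom R S) :
  opcartesian P (fmh f) -> is_comm Y R -> is_comm Y S.
Proof.
intros og cR; set (F := self_hom P (fmh f)).
apply (opcartesian_epi (g := otimes_hom O F F)).
{ apply otimes_hom_opcartesian; exact og. }
change (hom_of (vmul S) ∘ hom_of (os_braid Y (self P S) (self P S))
        ∘ hom_of (otimes_hom O F F)
        = hom_of (vmul S) ∘ hom_of (otimes_hom O F F)).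
rewrite <- comp_assoc, os_nat, comp_assoc; unfold F.
rewrite fmh_vmul, <- comp_assoc; f_equal; exact (vertical_eq cR).
Qed.

Lemma Comm_base_opfibration (E B : Category) (P : Functor E B)
  (O : MonoidalOpfibration P) (Y : OpfibrationSymmetry O) :
  is_opfibration (Comm_base Y).
Proof.
intros A A' u [[R cR] eR]; cbn in eR; subst A.
destruct (monoid_opcartesian_lift u) as [S [f [Hf og]]].
pose proof (is_comm_opcartesian og cR) as cS.
assert (eS : P (fm_ob S) = A') by exact (f_equal (@tgt B) Hf).
exists (@MkFib (Comm Y) B (Comm_base Y) A' (exist (is_comm Y) S cS) eS).
exists (@MkHomOver (Comm Y) B (Comm_base Y) _ _ u
  (@MkFib (Comm Y) B (Comm_base Y) _ (exist (is_comm Y) R cR) eq_refl)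
  (@MkFib (Comm Y) B (Comm_base Y) A' (exist (is_comm Y) S cS) eS) f Hf).
(* [Comm Y] is full in [Mon O], so the universal property restricts. *)
intros Z h w e.
exact (@fmh_opcartesian E B P O R S f og (proj1_sig Z) h w e).
Qed.

(** * Coequalizers in a fibre tested by arrows over the base *)

(* Preservation by [u_*] is what extends the universal property of [q] from
   vertical arrows to arrows over [u]. *)
Lemma coequalizer_over (E B : Category) (P : Functor E B) (c : Cleavage P)
  (A A' : B) (u : Hom A A') (X Y Q : Fibre P A) (f g : Hom X Y) (q : Hom Y Q)
  (Z : Fib P A') (h : HomOver u Y Z) :
  preserves_reflexive_coequalizers (direct_image c u) ->
  reflexive_pair f g -> is_coequalizer f g q ->
  hom_of h ∘ hom_of f = hom_of h ∘ hom_of g ->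
  exists k : HomOver u Q Z, hom_of k ∘ hom_of q = hom_of h.
Proof.
intros pu r cq e.
destruct (pu _ _ _ _ _ _ r cq) as [_ U]; cbn in U.
(* The vertical arrow [h'] out of [u_* Y] corresponds to [h]; it coequalizes the image pair, as is
   seen after the lift at [X]. *)
destruct (opcartesian_factor h (@lift_opcartesian _ _ _ c _ _ u Y)) as [h' eh].
destruct (U Z h') as [k [ek _]].
{ apply (opcartesian_epi (@lift_opcartesian _ _ _ c _ _ u X)); cbn.
  rewrite <- !comp_assoc, !direct_image_homE, !comp_assoc, eh; exact e. }
exists (post_vertical k (lift c u Q)); cbn.
rewrite <- comp_assoc, <- direct_image_homE, comp_assoc, <- eh.
exact (f_equal (fun l => comp l _) (vertical_eq ek)).
Qed.

(** Arrows over [u] out of [Q] correspond to vertical ones out of [u_* Q], and [u_* q] is epi, being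
    a coequalizer. *)
Lemma coequalizer_over_epi (E B : Category) (P : Functor E B) (c : Cleavage P)
  (A A' : B) (u : Hom A A') (X Y Q : Fibre P A) (f g : Hom X Y) (q : Hom Y Q)
  (Z : Fib P A') (k k' : HomOver u Q Z) :
  preserves_reflexive_coequalizers (direct_image c u) ->
  reflexive_pair f g -> is_coequalizer f g q ->
  hom_of k ∘ hom_of q = hom_of k' ∘ hom_of q -> hom_of k = hom_of k'.
Proof.
intros pu r cq e.
pose proof (pu _ _ _ _ _ _ r cq) as cq'; cbn in cq'.
pose proof (@lift_opcartesian _ _ _ c _ _ u Q) as oQ.
destruct (opcartesian_factor k oQ) as [l el].
destruct (opcartesian_factor k' oQ) as [l' el'].
rewrite <- el, <- el'; f_equal; apply vertical_eq.
apply (coequalizer_epi cq').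
apply (opcartesian_epi (@lift_opcartesian _ _ _ c _ _ u Y)); cbn.
rewrite <- !comp_assoc, !direct_image_homE, !comp_assoc, el, el'; exact e.
Qed.

(** * Modules and maps linear along a monoid morphism *)

Definition vact (E B : Category) (P : Functor E B)
  (O : MonoidalOpfibration P) (N : FibModule O) :
  HomOver (idm _) (otimes O (md_ob N) (self P (md_mon N))) (md_ob N) :=
  act (md_str N).

Definition vunit (E B : Category) (P : Functor E B)
  (O : MonoidalOpfibration P) (S : FibMonoid O) (X : Fib P (P S)) :
  HomOver (idm _) X (otimes O X (self P S)) :=
  @free_unit (fibre_monoidal O (P S)) (self P S) (fm_str S) X.

Definition vfree (E B : Category) (P : Functor E B)
  (O : MonoidalOpfibration P) (S : FibMonoid O) (X : Fib P (P S)) :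
  HomOver (idm _) (otimes O (otimes O X (self P S)) (self P S))
    (otimes O X (self P S)) :=
  act (@free_module (fibre_monoidal O (P S)) (self P S) (fm_str S) X).

Definition vextend (E B : Category) (P : Functor E B)
  (O : MonoidalOpfibration P) (S : FibMonoid O) (W X : Fib P (P S))
  (t : HomOver (idm _) W (otimes O X (self P S))) :
  HomOver (idm _) (otimes O W (self P S)) (otimes O X (self P S)) :=
  @free_extend (fibre_monoidal O (P S)) (self P S) (fm_str S) W
    (otimes O X (self P S))
    (@free_module (fibre_monoidal O (P S)) (self P S) (fm_str S) X) t.

Lemma vact_assoc (E B : Category) (P : Functor E B)
  (O : MonoidalOpfibration P) (N : FibModule O) :
  hom_of (vact N) ∘ hom_of (otimes_hom O (vact N) (vid (self P (md_mon N))))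
  = hom_of (vact N)
    ∘ (hom_of (otimes_hom O (vid (md_ob N)) (vmul (md_mon N)))
    ∘ hom_of (vassoc O (md_ob N) (self P (md_mon N)) (self P (md_mon N)))).
Proof. rewrite comp_assoc; exact (vertical_eq (act_assoc (md_str N))). Qed.

Lemma vact_unit (E B : Category) (P : Functor E B)
  (O : MonoidalOpfibration P) (N : FibModule O) :
  hom_of (vact N) ∘ hom_of (@vunit _ _ _ O _ (md_ob N)) = idm _.
Proof.
exact (vertical_eq (act_free_unit (md_str N))).
Qed.

Lemma vunit_vrunit (E B : Category) (P : Functor E B)
  (O : MonoidalOpfibration P) (S : FibMonoid O) (X : Fib P (P S)) :
  hom_of (vunit X) ∘ hom_of (vrunit O X)
  = hom_of (otimes_hom O (vid X) (vone S)).
Proof.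
exact (vertical_eq (free_unit_mrunit (fm_str S) X)).
Qed.

Lemma vfree_vunit (E B : Category) (P : Functor E B)
  (O : MonoidalOpfibration P) (S : FibMonoid O) (X : Fib P (P S)) :
  hom_of (vfree X) ∘ hom_of (otimes_hom O (vunit X) (vid (self P S))) = idm _.
Proof. exact (vertical_eq (free_extend_id (fm_str S) X)). Qed.

Lemma vextend_map (E B : Category) (P : Functor E B)
  (O : MonoidalOpfibration P) (S : FibMonoid O) (W X : Fib P (P S))
  (t : HomOver (idm _) W (otimes O X (self P S))) :
  @module_map (fibre_monoidal O (P S)) (self P S) (fm_str S) _ _
    (free_module (fm_str S) W) (free_module (fm_str S) X) (vextend t).
Proof. apply free_extend_map. Qed.

Lemma vextend_vfree (E B : Category) (P : Functor E B)
  (O : MonoidalOpfibration P) (S : FibMonoid O) (W X : Fib P (P S))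
  (t : HomOver (idm _) W (otimes O X (self P S))) :
  hom_of (vfree X) ∘ hom_of (otimes_hom O (vextend t) (vid (self P S)))
  = hom_of (vextend t) ∘ hom_of (vfree W).
Proof. exact (vertical_eq (vextend_map t)). Qed.

(** The composite is the linear extension of [t ∘ s], hence of the unit of the free module. This
    provides the common section of the reflexive pair. *)
Lemma vextend_section (E B : Category) (P : Functor E B)
  (O : MonoidalOpfibration P) (S : FibMonoid O) (W X : Fib P (P S))
  (t : HomOver (idm _) W (otimes O X (self P S))) (s : HomOver (idm _) X W) :
  hom_of t ∘ hom_of s = hom_of (vunit X) ->
  hom_of (vextend t) ∘ hom_of (otimes_hom O s (vid (self P S))) = idm _.
Proof.
intros e; change (hom_of (vextend t)) with
  (hom_of (vfree X) ∘ hom_of (otimes_hom O t (vid (self P S)))).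
rewrite <- comp_assoc, (otimes_comp O (g' := vid _) (g := vid _)
  (g'' := vid (self P S)) e (comp_id_l _)).
apply vfree_vunit.
Qed.

Lemma vextend_vunit (E B : Category) (P : Functor E B)
  (O : MonoidalOpfibration P) (S : FibMonoid O) (W X : Fib P (P S))
  (t : HomOver (idm _) W (otimes O X (self P S))) :
  hom_of (vextend t) ∘ hom_of (vunit W) = hom_of t.
Proof.
exact (vertical_eq (free_extend_unit
  (@free_module (fibre_monoidal O (P S)) (self P S) (fm_str S) X) t)).
Qed.

(** The inverse of the unitor in the fibre is also an inverse in [E], so it cancels before arrows
    over any base arrow. *)
Lemma vrunit_epi (E B : Category) (P : Functor E B)
  (O : MonoidalOpfibration P) (A : B) (X : Fib P A) (Z : E)
  (f g : Hom (fib_ob X) Z) :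
  f ∘ hom_of (vrunit O X) = g ∘ hom_of (vrunit O X) -> f = g.
Proof.
apply iso_epi.
destruct (@mo_runit_iso _ _ _ O A X) as [r [e1 e2]].
exists (hom_of r); split; [exact (vertical_eq e1) | exact (vertical_eq e2)].
Qed.

(** Precomposed with the right unitor, the square expresses that [f] preserves units. *)
Lemma vunit_nat (E B : Category) (P : Functor E B)
  (O : MonoidalOpfibration P) (R S : FibMonoid O) (f : FibMonoidHom R S)
  (X : Fib P (P R)) (Y : Fib P (P S)) (x : HomOver (fmap P (fmh f)) X Y) :
  hom_of (otimes_hom O x (self_hom P (fmh f))) ∘ hom_of (vunit X)
  = hom_of (vunit Y) ∘ hom_of x.
Proof.
apply (vrunit_epi (O := O)).
rewrite <- !comp_assoc, vunit_vrunit, <- vrunit_nat, comp_assoc, vunit_vrunit.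
symmetry; apply otimes_square; [apply vid_swap | apply fmh_vone].
Qed.

(* [X ⊗ S] is the free [S]-module on [X] also with respect to arrows over [P w]
   that are linear along [w]. *)
Lemma free_extension (E B : Category) (P : Functor E B)
  (O : MonoidalOpfibration P) (S : FibMonoid O) (N : FibModule O)
  (w : FibMonoidHom S (md_mon N)) (X : Fib P (P S))
  (x : HomOver (fmap P (fmh w)) X (md_ob N)) :
  exists z : HomOver (fmap P (fmh w)) (otimes O X (self P S)) (md_ob N),
    hom_of z = hom_of (vact N) ∘ hom_of (otimes_hom O x (self_hom P (fmh w)))
    /\ hom_of z ∘ hom_of (vunit X) = hom_of x
    /\ hom_of (vact N) ∘ hom_of (otimes_hom O z (self_hom P (fmh w)))
       = hom_of z ∘ hom_of (vfree X).
Proof.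
exists (post_vertical (vact N) (otimes_hom O x (self_hom P (fmh w)))).
set (F := self_hom P (fmh w)).
split; [reflexivity | split].
- cbn [post_vertical hom_of]; unfold F.
  rewrite <- comp_assoc, vunit_nat, comp_assoc, vact_unit; apply comp_id_l.
- set (xF := otimes_hom O x F).
  rewrite <- (otimes_comp O (f' := vact N) (f := xF)
    (f'' := post_vertical (vact N) xF) (g' := vid _) (g := F) (g'' := F)
    eq_refl (comp_id_l _)).
  change (hom_of (post_vertical (vact N) xF)) with (hom_of (vact N) ∘ hom_of xF).
  change (hom_of (vfree X)) with
    (hom_of (otimes_hom O (vid X) (vmul S))
     ∘ hom_of (vassoc O X (self P S) (self P S))).
  rewrite comp_assoc, vact_assoc, <- !comp_assoc; f_equal.
  unfold xF; rewrite vassoc_nat, !comp_assoc; f_equal.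
  apply otimes_square; [apply vid_swap | apply fmh_vmul].
Qed.

(** Linearity along [w] recovers [z] from its restriction to [X]: inserting
    [vfree ∘ (vunit ⊗ S) = id] gives [z = act ∘ ((z ∘ vunit) ⊗ w)]. *)
Lemma free_semilinear_ext (E B : Category) (P : Functor E B)
  (O : MonoidalOpfibration P) (S : FibMonoid O) (N : FibModule O)
  (w : FibMonoidHom S (md_mon N)) (X : Fib P (P S))
  (z z' : HomOver (fmap P (fmh w)) (otimes O X (self P S)) (md_ob N)) :
  hom_of (vact N) ∘ hom_of (otimes_hom O z (self_hom P (fmh w)))
  = hom_of z ∘ hom_of (vfree X) ->
  hom_of (vact N) ∘ hom_of (otimes_hom O z' (self_hom P (fmh w)))
  = hom_of z' ∘ hom_of (vfree X) ->
  hom_of z ∘ hom_of (vunit X) = hom_of z' ∘ hom_of (vunit X) ->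
  hom_of z = hom_of z'.
Proof.
intros H H' e.
rewrite <- (comp_id_r (hom_of z)), <- (comp_id_r (hom_of z')), <- vfree_vunit.
rewrite !comp_assoc, <- H, <- H', <- !comp_assoc; f_equal.
apply otimes_square; [exact e | reflexivity].
Qed.

Lemma semilinear_vextend (E B : Category) (P : Functor E B)
  (O : MonoidalOpfibration P) (S : FibMonoid O) (N : FibModule O)
  (w : FibMonoidHom S (md_mon N)) (W X : Fib P (P S))
  (z : HomOver (fmap P (fmh w)) (otimes O X (self P S)) (md_ob N))
  (t : HomOver (idm _) W (otimes O X (self P S))) :
  hom_of (vact N) ∘ hom_of (otimes_hom O z (self_hom P (fmh w)))
  = hom_of z ∘ hom_of (vfree X) ->
  hom_of (vact N)
  ∘ hom_of (otimes_hom O (pre_vertical z (vextend t)) (self_hom P (fmh w)))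
  = hom_of (pre_vertical z (vextend t)) ∘ hom_of (vfree W).
Proof.
intros H; cbn [pre_vertical hom_of].
rewrite <- comp_assoc, <- vextend_vfree, comp_assoc, <- H, <- comp_assoc; f_equal; symmetry.
apply otimes_comp; [reflexivity | apply comp_id_r].
Qed.

(** * Opcartesian lifts of modules by extension of scalars *)

Lemma module_opcartesian_lift (E B : Category) (P : Functor E B)
  (O : MonoidalOpfibration P) (c : Cleavage P)
  (has_coeq : forall A : B, has_reflexive_coequalizers (Fibre P A))
  (direct_image_coeq : forall (A A' : B) (f : @Hom B A A'),
    preserves_reflexive_coequalizers (direct_image c f))
  (tensor_coeq : forall X : E,
    preserves_reflexive_coequalizers
      (@tensor_right (fibre_monoidal O (fob P X)) (self P X)))
  (M : FibModule O) (S : FibMonoid O) (f : FibMonoidHom (md_mon M) S) :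
  exists (Q : Fib P (P S))
    (d : @RightModule (fibre_monoidal O (P S)) (self P S) (fm_str S) Q)
    (g : FibModuleHom M (MkFibModule d)),
    mdh_mon g = f /\
    @opcartesian (Mod O) (Mon O) (Mod_Mon O) M (MkFibModule d) g.
Proof.
set (F := self_hom P (fmh f)).
set (lX := lift c (fmap P (fmh f)) (md_ob M)).
set (lW := lift c (fmap P (fmh f)) (otimes O (md_ob M) (self P (md_mon M)))).
pose proof (@lift_opcartesian _ _ _ c _ _ (fmap P (fmh f)) (md_ob M)) as oX; fold lX in oX.
pose proof (@lift_opcartesian _ _ _ c _ _ (fmap P (fmh f)) (otimes O (md_ob M) (self P (md_mon M)))) as oW.
fold lW in oW.
set (X := lift_ob c (fmap P (fmh f)) (md_ob M)) in *.
set (W := lift_ob c (fmap P (fmh f)) (otimes O (md_ob M) (self P (md_mon M)))) in *.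
set (ka := direct_image_hom c (fmap P (fmh f)) (vact M) : HomOver (idm (P S)) W X).
assert (eka : hom_of ka ∘ hom_of lW = hom_of lX ∘ hom_of (vact M))
  by apply direct_image_homE.
(* The direct image of [M -> M ⊗ R], insertion of the unit of [R]; [t ⊗ S] will be the common
   section. *)
set (t := direct_image_hom c (fmap P (fmh f)) (vunit (md_ob M)) : HomOver (idm (P S)) X W).
assert (et : hom_of t ∘ hom_of lX = hom_of lW ∘ hom_of (vunit (md_ob M)))
  by apply direct_image_homE.
destruct (opcartesian_factor (otimes_hom O lX F) oW) as [th eth].
set (tha := post_vertical (vunit X) ka).
assert (rt : hom_of ka ∘ hom_of t = idm _).
{ apply (vertical_eq (f := post_vertical ka t) (g := vid X)).
  apply (opcartesian_epi oX); cbn [post_vertical hom_of].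
  rewrite <- comp_assoc, et, comp_assoc, eka, <- comp_assoc, vact_unit.
  cbn; rewrite comp_id_l; apply comp_id_r. }
assert (rth : hom_of th ∘ hom_of t = hom_of (vunit X)).
{ apply (vertical_eq (f := post_vertical th t)).
  apply (opcartesian_epi oX); cbn [post_vertical hom_of].
  rewrite <- comp_assoc, et, comp_assoc, eth; apply vunit_nat. }
set (a := vextend tha : @Hom (Fibre P (P S)) (otimes O W (self P S))
  (otimes O X (self P S))).
set (b := vextend th : @Hom (Fibre P (P S)) (otimes O W (self P S))
  (otimes O X (self P S))).
assert (r : reflexive_pair a b).
{ exists (@ftens_hom _ _ _ O _ X W (self P S) (self P S) t (idm _)).
  split; apply HomOver_eq.
  - apply vextend_section; cbn [tha post_vertical hom_of].
    rewrite <- comp_assoc, rt; apply comp_id_r.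
  - apply vextend_section; exact rth. }
destruct (has_coeq _ _ _ a b r) as [Q [q cq]].
destruct (@module_coequalizer (fibre_monoidal O (P S)) (self P S) (fm_str S)
  _ _ Q (free_module (fm_str S) W) (free_module (fm_str S) X) a b q
  (tensor_coeq S) (vextend_map tha) (vextend_map th) r cq)
  as [d dq].
pose (N := MkFibModule d).
set (va := act d : HomOver (idm (P S)) (otimes O Q (self P S)) Q).
assert (eq_q : hom_of va ∘ hom_of (otimes_hom O q (vid (self P S)))
          = hom_of q ∘ hom_of (vfree X)) by exact (vertical_eq dq).
assert (eq_ab : hom_of q ∘ hom_of a = hom_of q ∘ hom_of b)
  by exact (vertical_eq (proj1 cq)).
(* Restricting [a] and [b] along the unit of the free module on [W] recovers [tha] and [th]. *)
assert (eq_th : hom_of q ∘ hom_of tha = hom_of q ∘ hom_of th).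
{ rewrite <- (vextend_vunit th), <- (vextend_vunit tha), !comp_assoc.
  exact (f_equal (fun l => comp l _) eq_ab). }
(* The canonical map [M -> u_* M -> u_* M ⊗ S -> Q], informally [m ↦ m ⊗ 1]. *)
set (be := post_vertical q (post_vertical (vunit X) lX)).
assert (ebe : hom_of va ∘ hom_of (otimes_hom O be F)
              = hom_of be ∘ hom_of (vact M)).
{ set (eX := post_vertical (vunit X) lX).
  rewrite <- (otimes_comp O (f' := q) (f := eX)
    (f'' := be) (g' := vid _) (g := F) (g'' := F) eq_refl (comp_id_l _)).
  rewrite <- (otimes_comp O (f' := vunit X) (f := lX)
    (f'' := eX) (g' := vid _) (g := F) (g'' := F) eq_refl (comp_id_l _)).
  rewrite comp_assoc, eq_q, <- comp_assoc, (comp_assoc (hom_of (vfree X))).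
  (* Acting after [be ⊗ F] is now [q] after [lX ⊗ F], that is [q ∘ th ∘ lW]; the coequalizer
     relation replaces [th] by [tha], which contains the action of [M]. *)
  rewrite vfree_vunit, comp_id_l, <- eth, comp_assoc, <- eq_th.
  cbn [be tha eX post_vertical hom_of].
  rewrite <- !comp_assoc, eka; reflexivity. }
exists Q, d, (@MkFibModuleHom E B P O M N f be ebe).
split; [reflexivity|].
intros Z [ch ga ega] w e; cbn in w, e, ga, ega |- *; subst ch.
set (K := self_hom P (fmh w)); set (H := self_hom P (fmh w ∘ fmh f)).
change (hom_of (vact Z) ∘ hom_of (otimes_hom O ga H)
        = hom_of ga ∘ hom_of (vact M)) in ega.
(* The test arrow [ga] factors through [u_* M] as [x], whose linear extension [z] to [u_* M ⊗ S]
   must then descend to [Q]. *)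
destruct (opcartesian_over ga oX (eq_sym (fmap_comp P (fmh w) (fmh f))))
  as [x [ex _]].
destruct (free_extension x) as [z [ez [ezu ezs]]].
assert (zab : hom_of z ∘ hom_of (vextend tha) = hom_of z ∘ hom_of (vextend th)).
(* Both composites are linear along [w], so they are compared on [W], then on [M ⊗ R], where their
   equality is linearity of [ga]. *)
{ apply (free_semilinear_ext (z := pre_vertical z (vextend tha))
    (z' := pre_vertical z (vextend th))); try apply semilinear_vextend, ezs.
  cbn [pre_vertical hom_of]; rewrite <- !comp_assoc, !vextend_vunit.
  apply (vertical_eq (f := pre_vertical z tha) (g := pre_vertical z th)).
  apply (opcartesian_epi oW).
  cbn [pre_vertical tha post_vertical hom_of].
  rewrite !comp_assoc, ezu, <- !comp_assoc, eka, eth, comp_assoc, ex, <- ega, ez.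
  rewrite <- comp_assoc; f_equal; symmetry.
  apply otimes_comp; [exact ex | reflexivity]. }
destruct (coequalizer_over (direct_image_coeq _ _ _) r cq zab) as [k ek].
assert (eks : hom_of (vact Z) ∘ hom_of (otimes_hom O k K) = hom_of k ∘ hom_of va).
(* Linearity of [k] is tested on [q ⊗ S], a coequalizer of the pair tensored with [S]. *)
{ set (TS := @tensor_right (fibre_monoidal O (P S)) (self P S)).
  apply (coequalizer_over_epi (c := c)
    (k := post_vertical (vact Z) (otimes_hom O k K)) (k' := pre_vertical k va)
    (direct_image_coeq _ _ _) (fmap_reflexive_pair TS r)
    (tensor_coeq S _ _ _ _ _ _ r cq)).
  change (hom_of (vact Z) ∘ hom_of (otimes_hom O k K)
    ∘ hom_of (otimes_hom O q (vid (self P S)))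
    = hom_of k ∘ hom_of va ∘ hom_of (otimes_hom O q (vid (self P S)))).
  rewrite <- !comp_assoc, eq_q, (comp_assoc (hom_of k)), ek, <- ezs; f_equal.
  apply otimes_comp; [exact ek | apply comp_id_r]. }
exists (@MkFibModuleHom E B P O N Z w k eks).
split.
- split; [reflexivity|].
  apply FibModuleHom_eq; [reflexivity|].
  change (hom_of k ∘ (hom_of q ∘ (hom_of (vunit X) ∘ hom_of lX)) = hom_of ga).
  rewrite comp_assoc, ek, comp_assoc, ezu; exact ex.
- intros [w' k' ek'] [e1 e2]; cbn in e1; subst w'.
  apply (f_equal (fun g => hom_of (mdh_map g))) in e2.
  set (l := k' : HomOver (fmap P (fmh w)) Q (md_ob Z)).
  change (hom_of l ∘ hom_of be = hom_of ga) in e2.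
  change (hom_of (vact Z) ∘ hom_of (otimes_hom O l K) = hom_of l ∘ hom_of va)
    in ek'.
  apply FibModuleHom_eq; [reflexivity|].
  apply (coequalizer_over_epi (k := k) (k' := l) (direct_image_coeq _ _ _) r cq).
  rewrite ek.
  (* For uniqueness, [l ∘ q] is linear along [w] and agrees with [z] on [u_* M], since both restrict
     to [ga] on [M]. *)
  apply (free_semilinear_ext (z' := pre_vertical l q)); [exact ezs| |].
  + cbn [pre_vertical hom_of]; rewrite <- comp_assoc, <- eq_q, comp_assoc, <- ek'.
    rewrite <- comp_assoc; f_equal; symmetry.
    apply otimes_comp; [reflexivity | apply comp_id_r].
  + rewrite ezu.
    apply (vertical_eq (g := pre_vertical (pre_vertical l q) (vunit X))).
    apply (opcartesian_epi oX); rewrite ex, <- e2.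
    cbn [pre_vertical be post_vertical hom_of]; rewrite !comp_assoc; reflexivity.
Qed.

Theorem proposition2p3 (E B : Category) (P : Functor E B)
  (O : MonoidalOpfibration P) (c : Cleavage P)
  (has_coeq : forall A : B, has_reflexive_coequalizers (Fibre P A))
  (direct_image_coeq : forall (A A' : B) (f : @Hom B A A'),
    preserves_reflexive_coequalizers (direct_image c f))
  (tensor_coeq : forall X : E,
    preserves_reflexive_coequalizers
      (@tensor_right (fibre_monoidal O (fob P X)) (self P X))) :
  (is_opfibration (Mod_Mon O) /\ is_opfibration (Mon_base O)) /\
  (forall S : OpfibrationSymmetry O,
    is_opfibration (Modc_Comm S) /\ is_opfibration (Comm_base S)).
Proof.
split; [split | intros Y; split].
- intros R S f [M eM]; cbn in eM; subst R.
  destruct (module_opcartesian_lift has_coeq direct_image_coeq tensor_coeq f)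
    as [Q [d [g [eg og]]]].
  exists (@MkFib (Mod O) (Mon O) (Mod_Mon O) S (MkFibModule d) eq_refl).
  exists (@MkHomOver (Mod O) (Mon O) (Mod_Mon O) _ _ f
    (@MkFib (Mod O) (Mon O) (Mod_Mon O) _ M eq_refl)
    (@MkFib (Mod O) (Mon O) (Mod_Mon O) S (MkFibModule d) eq_refl) g
    (f_equal (@Arrow (Mon O) (md_mon M) S) eg)).
  exact og.
- apply Mon_base_opfibration.
- intros R [S cS] f [[M cM] eM]; cbn in eM; subst R.
  destruct (module_opcartesian_lift has_coeq direct_image_coeq tensor_coeq
    (M := M) f) as [Q [d [g [eg og]]]].
  (* Commutativity only concerns the monoid [S], so the lift built in [Mod O] already lies in
     [Modc Y]; its universal property restricts by fullness. *)
  pose (N := exist (fun M : Mod O => is_comm Y (md_mon M)) (MkFibModule d) cS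
    : Modc Y).
  exists (@MkFib (Modc Y) (Comm Y) (Modc_Comm Y) (exist _ S cS) N eq_refl).
  exists (@MkHomOver (Modc Y) (Comm Y) (Modc_Comm Y) _ _ f
    (@MkFib (Modc Y) (Comm Y) (Modc_Comm Y) _ (exist _ M cM) eq_refl)
    (@MkFib (Modc Y) (Comm Y) (Modc_Comm Y) (exist _ S cS) N eq_refl) g
    (f_equal (@Arrow (Comm Y) (exist _ (md_mon M) cM) (exist _ S cS)) eg)).
  intros Z h w e; exact (og (proj1_sig Z) h w e).
- apply Comm_base_opfibration.
Qed.
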